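(* The class $\overline{\mathcal B}$ (the hereditary closure of the class of all homogenising lifts $L_2(\mathbf G)$ of ordered good bowtie-free graphs $\mathbf G$) is a Ramsey class.
   Context: Graphs are finite, simple and undirected. A bowtie is the graph consisting of two triangles sharing exactly one vertex; a graph is bowtie-free if it has no (not necessarily induced) subgraph isomorphic to a bowtie. For $n\ge 2$ the chimney $Ch_n$ is the graph formed by $n$ triangles sharing one common edge (and otherwise disjoint, with no further edges). A bowtie-free graph is good if every vertex is contained in an induced copy of some chimney or in a copy of $K_4$. For a graph $G=(V,E)$, $E_0(G)$ is the set of edges lying in triangles and $E_1(G)=E\setminus E_0(G)$. For a good bowtie-free graph, a vertex is central if it lies in at least two triangles, and non-central otherwise; the centre $c(v)$ of a vertex $v$ is the subgraph induced by all central vertices in the connected component of $(V,E_0)$ containing $v$ (it is either the common edge of a chimney or a $K_4$). Lift $L_0$: an ordered good bowtie-free graph is a structure $\mathbf G=(V,R^{E_0},R^{E_1},\le_{\mathbf G})$ where $G=(V,E)$ is a good bowtie-free graph, $R^{E_0}=E_0(G)$, $R^{E_1}=E_1(G)$ (as symmetric binary relations), and $\le_{\mathbf G}$ is an admissible ordering, i.e. a linear order of $V$ such that: (1) the vertices of the centre of every vertex form an interval; (2) all centres of chimneys come before vertices in copies of $K_4$; (3) all central vertices come before non-central vertices; (4) the non-central vertices belonging to a given chimney form an interval, and the relative order of these intervals follows the relative order of the corresponding centres. $\mathcal B_0$ is the class of all ordered good bowtie-free graphs. Lift $L_1$: for $\mathbf G\in\mathcal B_0$, $L_1(\mathbf G)$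 adds unary relations $R^\ell,R^r,R^1,R^2,R^3,R^4$: for every pair $u<_{\mathbf G}v$ forming the centre of a chimney put $u\in R^\ell$, $v\in R^r$; for all $a<_{\mathbf G}b<_{\mathbf G}c<_{\mathbf G}d$ that are the vertices of a copy of $K_4$ put $a\in R^1$, $b\in R^2$, $c\in R^3$, $d\in R^4$. Lift $L_2$: for distinct vertices $u,v$ of $\mathbf G\in\mathcal B_0$, let $t(u,v)$ be the isomorphism type of the structure induced by $L_1(\mathbf G)$ on $\{u,v\}\cup c(u)\cup c(v)$, rooted at $(u,v)$ (isomorphisms preserve the ordered pair of roots). Let $t_1,\dots,t_N$ enumerate all (finitely many) possible such types. $L_2(\mathbf G)$ is $L_1(\mathbf G)$ with additional binary relations $R^{t_1},\dots,R^{t_N}$, where for $u<_{\mathbf G}v$ we put $(u,v)\in R^{t(u,v)}$ (and no other tuples). $\mathcal B_2$ is the class of all $L_2(\mathbf G)$, $\mathbf G\in\mathcal B_0$, and $\overline{\mathcal B}$ is the class of all (induced) substructures of structures in $\mathcal B_2$. $\binom{\mathbf B}{\mathbf A}$ denotes the set of all (induced) substructures of $\mathbf B$ isomorphic to $\mathbf A$. A class $\mathcal C$ is a Ramsey class if for all $\mathbf A,\mathbf B\in\mathcal C$ and every positive integer $k$ there is $\mathbf C\in\mathcal C$ such that for every partition of $\binom{\mathbf C}{\mathbf A}$ into $k$ classes there is $\widetilde{\mathbf B}\in\binom{\mathbf C}{\mathbf B}$ such that $\binom{\widetilde{\mathbf B}}{\mathbf A}$ is contained in one class of the partition. *)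

(* Defs.v *)
From mathcomp Require Import all_boot.
From Stdlib Require Classical_Prop ClassicalEpsilon.

Set Implicit Arguments.
Unset Strict Implicit.
Unset Printing Implicit Defensive.

(* Every language below has unary and binary relation symbols only. *)
Record lang := Lang { unary : Type; binary : Type }.

Record structure (L : lang) := Structure {
  carrier :> finType;
  unR : unary L -> carrier -> Prop;
  binR : binary L -> carrier -> carrier -> Prop }.

Definition isomorphism (L : lang) (A B : structure L) (f : A -> B) : Prop :=
  [/\ bijective f,
      forall s x, unR s x <-> unR s (f x)
    & forall s x y, binR s x y <-> binR s (f x) (f y)].

Definition isomorphic (L : lang) (A B : structure L) : Prop :=
  exists f : A -> B, isomorphism f.

Definition induced (L : lang) (M : structure L) (S : {set M}) : structure L :=
  @Structure L {x : M | x \in S}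
    (fun s x => unR s (val x))
    (fun s x y => binR s (val x) (val y)).

(* An element of binom(C, A), i.e. a substructure of C isomorphic to A, is
   represented by its vertex set. *)
Definition is_copy (L : lang) (A C : structure L) (S : {set C}) : Prop :=
  isomorphic (induced S) A.

(* A partition of binom(C, A) into k classes is given by a colouring chi; only
   the values of chi on vertex sets of copies of A matter. *)
Definition ramsey_class (L : lang) (K : structure L -> Prop) : Prop :=
  forall A B : structure L, K A -> K B ->
  forall k : nat, 0 < k ->
  exists2 C : structure L, K C &
    forall chi : {set C} -> 'I_k,
    exists2 S : {set C}, is_copy B S &
    exists i : 'I_k, forall T : {set C}, T \subset S -> is_copy A T -> chi T = i.

Definition subgraph_copy (U V : finType) (h : rel U) (e : rel V)
    (f : U -> V) : Prop :=
  injective f /\ (forall x y, h x y -> e (f x) (f y)).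

Definition induced_copy (U V : finType) (h : rel U) (e : rel V)
    (f : U -> V) : Prop :=
  injective f /\ (forall x y, h x y = e (f x) (f y)).

(* The triangles {0,1,2} and {0,3,4}. *)
Definition bowtie : rel 'I_5 := fun x y =>
  (x != y) &&
  ((val x \in [:: 0; 1; 2]) && (val y \in [:: 0; 1; 2]) ||
   (val x \in [:: 0; 3; 4]) && (val y \in [:: 0; 3; 4])).

(* The triangles {0,1,i}, for 2 <= i < n + 2. *)
Definition chimney (n : nat) : rel 'I_n.+2 := fun x y =>
  (x != y) && ((x < 2) || (y < 2)).

Definition K4 : rel 'I_4 := fun x y => x != y.

Definition bowtie_free (V : finType) (e : rel V) : Prop :=
  ~ exists f : 'I_5 -> V, subgraph_copy bowtie e f.

Definition in_chimney (V : finType) (e : rel V) (v : V) : Prop :=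
  exists n (f : 'I_n.+2 -> V),
    [/\ 2 <= n, induced_copy (@chimney n) e f & exists i, f i = v].

Definition in_K4 (V : finType) (e : rel V) (v : V) : Prop :=
  exists2 f : 'I_4 -> V, subgraph_copy K4 e f & exists i, f i = v.

Definition good_graph (V : finType) (e : rel V) : Prop :=
  forall v, in_chimney e v \/ in_K4 e v.

(* The common edge of a chimney; symmetric in u and v, since exchanging 0 and 1
   is an automorphism of the chimney. *)
Definition chimney_centre (V : finType) (e : rel V) (u v : V) : Prop :=
  exists n (f : 'I_n.+2 -> V),
    [/\ 2 <= n, induced_copy (@chimney n) e f, f ord0 = u & f (inord 1) = v].

Definition E0 (V : finType) (e : rel V) : rel V := fun u v =>
  e u v && [exists w, e u w && e v w].

Definition E1 (V : finType) (e : rel V) : rel V := fun u v =>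
  e u v && ~~ E0 e u v.

Definition triangles (V : finType) (e : rel V) : {set {set V}} :=
  [set T : {set V} |
    (#|T| == 3) && [forall x in T, forall y in T, (x != y) ==> e x y]].

Definition central (V : finType) (e : rel V) (v : V) : bool :=
  2 <= #|[set T in triangles e | v \in T]|.

Definition same_component (V : finType) (e : rel V) : rel V := connect (E0 e).

Definition centre (V : finType) (e : rel V) (v : V) : {set V} :=
  [set u | central e u & same_component e v u].

(* The non-central vertices of the component of v; when the component is a K4
   this set is empty. *)
Definition noncentral_part (V : finType) (e : rel V) (v : V) : {set V} :=
  [set u | ~~ central e u & same_component e v u].

Definition linear_order (V : finType) (r : rel V) : Prop :=
  [/\ reflexive r, antisymmetric r, transitive r & total r].

Definition strict_rel (V : finType) (r : rel V) : rel V :=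
  fun x y => (x != y) && r x y.

Definition order_interval (V : finType) (r : rel V) (S : {set V}) : Prop :=
  forall x y z, x \in S -> z \in S -> r x y -> r y z -> y \in S.

Record admissible (V : finType) (e r : rel V) : Prop := Admissible {
  adm_linear : linear_order r;
  adm_centre : forall v, order_interval r (centre e v);
  adm_chimney_K4 : forall u v w,
    chimney_centre e u v -> in_K4 e w -> strict_rel r u w;
  adm_central : forall u v, central e u -> ~~ central e v -> strict_rel r u v;
  adm_noncentral : forall v, order_interval r (noncentral_part e v);
  adm_noncentral_order : forall u v x y,
    ~~ central e u -> ~~ central e v -> ~~ same_component e u v ->
    x \in centre e u -> y \in centre e v ->
    strict_rel r u v <-> strict_rel r x y }.

Record ordered_good_graph := OrderedGoodGraph {
  vertex :> finType;
  edge : rel vertex;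
  vle : rel vertex;
  edge_sym : symmetric edge;
  edge_irr : irreflexive edge;
  edge_bowtie_free : bowtie_free edge;
  edge_good : good_graph edge;
  vle_admissible : admissible edge vle }.

Definition vlt (G : ordered_good_graph) : rel G := strict_rel (@vle G).

Inductive bsym := R_E0 | R_E1 | R_le.

Definition lang0 : lang := Lang void bsym.

Definition bsymR (G : ordered_good_graph) (s : bsym) (x y : G) : Prop :=
  match s with
  | R_E0 => E0 (@edge G) x y
  | R_E1 => E1 (@edge G) x y
  | R_le => vle x y
  end.

Definition L0 (G : ordered_good_graph) : structure lang0 :=
  @Structure lang0 G (fun s : void => match s with end) (@bsymR G).

(* R_K i, for i = 0, 1, 2, 3, is the relation R^(i+1). *)
Inductive usym := R_l | R_r | R_K of 'I_4.

Definition lang1 : lang := Lang usym bsym.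

Definition usymR (G : ordered_good_graph) (s : usym) (x : G) : Prop :=
  match s with
  | R_l => exists2 y, vlt x y & chimney_centre (@edge G) x y
  | R_r => exists2 y, vlt y x & chimney_centre (@edge G) y x
  | R_K i => exists f : 'I_4 -> G,
      [/\ subgraph_copy K4 (@edge G) f,
          forall j k : 'I_4, j < k -> vlt (f j) (f k) & f i = x]
  end.

Definition L1 (G : ordered_good_graph) : structure lang1 :=
  @Structure lang1 G (@usymR G) (@binR lang0 (L0 G)).

Record rooted := Rooted {
  rooted_str :> structure lang1;
  root1 : rooted_str;
  root2 : rooted_str }.

Definition rooted_isomorphic (S T : rooted) : Prop :=
  exists f : S -> T,
    [/\ isomorphism f, f (root1 S) = root1 T & f (root2 S) = root2 T].

Definition type_support (G : ordered_good_graph) (u v : G) : {set G} :=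
  [set u; v] :|: centre (@edge G) u :|: centre (@edge G) v.

Lemma type_support1 (G : ordered_good_graph) (u v : G) :
  u \in type_support u v.
Proof. by rewrite !inE eqxx. Qed.

Lemma type_support2 (G : ordered_good_graph) (u v : G) :
  v \in type_support u v.
Proof. by rewrite !inE eqxx orbT. Qed.

(* t(u, v) is the isomorphism class of this rooted structure. *)
Definition pair_type (G : ordered_good_graph) (u v : G) : rooted :=
  @Rooted (@induced lang1 (L1 G) (type_support u v))
    (exist _ u (type_support1 u v)) (exist _ v (type_support2 u v)).

(* t lists one representative of each possible type t(u, v). Such a finite list
   exists: see type_enumeration_exists. *)
Record type_enumeration (N : nat) (t : 'I_N -> rooted) : Prop :=
  TypeEnumeration {
    enum_possible : forall i, exists (G : ordered_good_graph) (u v : G),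
      u != v /\ rooted_isomorphic (t i) (pair_type u v);
    enum_complete : forall (G : ordered_good_graph) (u v : G),
      u != v -> exists i, rooted_isomorphic (t i) (pair_type u v);
    enum_distinct : forall i j, rooted_isomorphic (t i) (t j) -> i = j }.

Lemma bowtie_free_meet (V : finType) (e : rel V) : symmetric e -> irreflexive e ->
  bowtie_free e ->
  forall x a b c d, e x a -> e x b -> e a b -> e x c -> e x d -> e c d ->
  [|| a == c, a == d, b == c | b == d].
Proof.
move=> es ei bf x a b c d xa xb ab xc xd cd; apply/negP=> /negP.
rewrite !negb_or => /and4P[ac ad bc bd]; apply: bf.
have neq y z : e y z -> y != z by apply: contraTneq => ->; rewrite ei.
have U : uniq [:: x; a; b; c; d].
  by rewrite /= !inE !negb_or ac ad bc bd !neq.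
exists (fun i : 'I_5 => nth x [:: x; a; b; c; d] i); split.
  by move=> i j /eqP; rewrite nth_uniq // => /eqP /val_inj.
by case=> [[|[|[|[|[|?]]]]] ?] // [[|[|[|[|[|?]]]]] ?] //=; rewrite /bowtie //= es.
Qed.

Lemma central_triangles (V : finType) (e : rel V) : symmetric e -> irreflexive e ->
  forall x, central e x -> exists T1 T2 : V * V, 
   [/\ [&& e x T1.1, e x T1.2 & e T1.1 T1.2],
       [&& e x T2.1, e x T2.2 & e T2.1 T2.2] &
       [set T1.1; T1.2] != [set T2.1; T2.2]].
Proof.
move=> es ei x /card_gt1P[S1 [S2 [h1 h2 ne]]].
have H (S : {set V}) : S \in [set T in triangles e | x \in T] ->
   exists T : V * V, [&& e x T.1, e x T.2 & e T.1 T.2] && (S == x |: [set T.1; T.2]).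
  rewrite !inE => /andP[/andP[/eqP c3 /forall_inP adj] xS].
  have c2 : #|S :\ x| == 2 by move: c3; rewrite (cardsD1 x) xS add1n => -[->].
  have [a [b [ab Sab]]] := cards2P _ c2.
  have aS : (a != x) && (a \in S) by rewrite -in_setD1 Sab !inE eqxx.
  have bS : (b != x) && (b \in S) by rewrite -in_setD1 Sab !inE eqxx orbT.
  move/andP: aS => [ax aS]; move/andP: bS => [bx bS].
  have ad y z : y \in S -> z \in S -> y != z -> e y z.
    by move=> yS zS; move/forall_inP: (adj _ yS) => /(_ _ zS) /implyP.
  exists (a, b) => /=; rewrite -Sab setD1K // eqxx andbT.
  by apply/and3P; split; apply: ad; rewrite // eq_sym.
have [T1 /andP[t1 /eqP e1]] := H _ h1; have [T2 /andP[t2 /eqP e2]] := H _ h2.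
exists T1, T2; split=> //; apply: contraNneq ne => E.
by rewrite e1 e2 E.
Qed.

Lemma central_chimney (V : finType) (e : rel V) : symmetric e -> irreflexive e ->
  bowtie_free e -> forall x, central e x -> exists a b c,
  [/\ [&& e x a, e x b & e a b], e x c && e a c & b != c].
Proof.
move=> es ei bf x /(central_triangles es ei)[[a b] [[c d] /= [/and3P[xa xb ab] /and3P[xc xd cd] ne]]].
have := bowtie_free_meet es ei bf xa xb ab xc xd cd; case/or4P=> /eqP E; subst.
- exists c, b, d; split; rewrite ?xc ?xd ?xb ?cd ?ab //.
  by apply: contraNneq ne => ->.
- exists d, b, c; split; rewrite ?xc ?xd ?xb ?(es d) ?cd -1?(es d) ?ab //.
  by apply: contraNneq ne => ->; rewrite setUC.
- exists c, a, d; split; rewrite ?xa ?xb ?xd ?(es c a) ?ab ?cd //.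
  by apply: contraNneq ne => ->; rewrite setUC.
- exists d, a, c; split; rewrite ?xa ?xb ?xc ?(es d) ?ab ?cd //.
  by apply: contraNneq ne => ->.
Qed.

Lemma E0_sym (V : finType) (e : rel V) : symmetric e -> symmetric (E0 e).
Proof.
by move=> es x y; rewrite /E0 es; congr andb; apply: eq_existsb => w; rewrite andbC.
Qed.

Lemma card_centre_central (V : finType) (e : rel V) : symmetric e -> irreflexive e ->
  bowtie_free e -> forall x, central e x -> #|centre e x| <= 4.
Proof.
move=> es ei bf x cx.
have [a [b [c [/and3P[xa xb ab] /andP[xc ac] bc]]]] := central_chimney es ei bf cx.
have meet := bowtie_free_meet es ei bf.
have edge3 y a' : (y == x) && (a' == a) || (y == a) && (a' == x) ->
  forall z w, e y z -> e y w -> e z w -> (z == a') || (w == a') ||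
   ((z == b) && (w == c) || (z == c) && (w == b)).
  move=> h z w yz yw zw.
  have [ya' yb yc a'b a'c] : [/\ e y a', e y b, e y c, e a' b & e a' c].
    by case/orP: h => /andP[/eqP-> /eqP->]; rewrite // es.
  have := meet _ _ _ _ _ yz yw zw ya' yb a'b.
  have := meet _ _ _ _ _ yz yw zw ya' yc a'c.
  have ex q : ~~ ((q == b) && (q == c)).
    by apply/negP=> /andP[/eqP-> E]; rewrite E in bc.
  move: (ex z) (ex w).
  by case: (z == a'); case: (w == a'); case: (z == b); case: (z == c);
     case: (w == b); case: (w == c).
pose P y := [|| y == x, y == a | e x y && e a y].
have clo y z : P y -> E0 e y z -> P z.
  move=> Py /andP[yz /existsP[w /andP[yw zw]]].
  have side u u' : (u == x) && (u' == a) || (u == a) && (u' == x) ->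
     forall z w, e u z -> e u w -> e z w -> P z.
    move=> h z1 w1 uz uw zw1.
    have := edge3 _ _ h _ _ uz uw zw1.
    case/orP=> [/orP[]/eqP E|/orP[]/andP[/eqP E _]].
    + by rewrite E; case/orP: h => /andP[_ /eqP->]; rewrite /P eqxx ?orbT.
    + move: uz zw1; rewrite E (es z1); case/orP: h => /andP[/eqP-> /eqP->].
        by rewrite /P => -> ->; rewrite !orbT.
      by rewrite /P => -> ->; rewrite !orbT.
    + by rewrite E /P xb ab !orbT.
    + by rewrite E /P xc ac !orbT.
  have hx : (x == x) && (a == a) || (x == a) && (a == x) by rewrite !eqxx.
  have ha : (a == x) && (x == a) || (a == a) && (x == x) by rewrite !eqxx orbT.
  case/or3P: Py => [/eqP E|/eqP E|/andP[xy ay]].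
  - by subst y; apply: side hx _ _ yz yw zw.
  - by subst y; apply: side ha _ _ yz yw zw.
  have := meet y z w x a yz yw zw; rewrite es xy es ay xa => /(_ isT isT isT).
  case/or4P=> /eqP E; subst.
  - by rewrite /P eqxx.
  - by rewrite /P eqxx orbT.
  - by apply: (side _ _ hx z y); rewrite // es.
  - by apply: (side _ _ ha z y); rewrite // es.
have sub : {subset centre e x <= [set x; a; b; c]}.
  move=> y; rewrite inE => /andP[cy /connectP[p pth lst]].
  have Py : P y.
    have : P x by rewrite /P eqxx.
    elim: p (x) pth lst => [|z p IH] u /=; first by move=> _ ->.
    by case/andP=> /clo uz pth lst /uz; apply: IH.
  case/or3P: Py => [/eqP->|/eqP->|/andP[xy ay]]; first by rewrite !inE eqxx.
    by rewrite !inE eqxx orbT.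
  have [[z1 w1] [[z2 w2] /= [t1 t2 ne]]] := central_triangles es ei cy.
  have [z [w [/and3P[yz yw zw] nzw]]] : exists z w, [&& e y z, e y w & e z w] /\ [set z; w] != [set x; a].
    case: (boolP ([set z1; w1] == [set x; a])) => [/eqP E|h]; last by exists z1, w1.
    by exists z2, w2; split=> //; rewrite -E eq_sym.
  have neq u v : e u v -> u != v by apply: contraTneq => ->; rewrite ei.
  have fin u u' s : (u == x) && (u' == a) || (u == a) && (u' == x) ->
     e u y -> e u s -> e y s -> y != u' -> s != u' -> y \in [set x; a; b; c].
    move=> h uy us ys yu su; have := edge3 _ _ h _ _ uy us ys.
    rewrite (negPf yu) (negPf su) /= => /orP[]/andP[/eqP-> _]; rewrite !inE eqxx ?orbT //.
  have hx : (x == x) && (a == a) || (x == a) && (a == x) by rewrite !eqxx.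
  have ha : (a == x) && (x == a) || (a == a) && (x == x) by rewrite !eqxx orbT.
  have ya : y != a by rewrite eq_sym neq.
  have yx : y != x by rewrite eq_sym neq.
  have := meet y z w x a yz yw zw; rewrite es xy es ay xa => /(_ isT isT isT).
  case/or4P=> /eqP E; subst.
  - apply: (fin _ _ w hx) => //; first by apply: contraNneq nzw => ->.
  - apply: (fin _ _ w ha) => //; first by apply: contraNneq nzw => ->; rewrite setUC.
  - apply: (fin _ _ z hx) => //; first by rewrite es.
    by apply: contraNneq nzw => ->; rewrite setUC.
  - apply: (fin _ _ z ha) => //; first by rewrite es.
    by apply: contraNneq nzw => ->.
apply: leq_trans (subset_leq_card (introT subsetP sub)) _.
by rewrite -setUA; apply: leq_trans (leq_card_setU _ _) _; rewrite !cards2; case: (_ != _); case: (_ != _).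
Qed.

Lemma card_centre (V : finType) (e : rel V) : symmetric e -> irreflexive e ->
  bowtie_free e -> forall v, #|centre e v| <= 4.
Proof.
move=> es ei bf v; case: (set_0Vmem (centre e v)) => [->|[x]]; first by rewrite cards0.
rewrite inE => /andP[cx vx].
suff -> : centre e v = centre e x by apply: card_centre_central.
apply/setP=> y; rewrite !inE /same_component; congr andb.
by rewrite (same_connect (sym_connect_sym (E0_sym es)) vx).
Qed.

Lemma isomorphism_refl (L : lang) (A : structure L) : isomorphism (@id A).
Proof. by split=> //; exists id. Qed.

Lemma isomorphism_inv (L : lang) (A B : structure L) (f : A -> B) g :
  isomorphism f -> cancel f g -> cancel g f -> isomorphism g.
Proof.
move=> [_ fu fb] fK gK; split; first by exists f.
  by move=> s x; rewrite -{1}(gK x) -fu.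
by move=> s x y; rewrite -{1}(gK x) -{1}(gK y) -fb.
Qed.

Lemma rooted_isomorphic_refl (S : rooted) : rooted_isomorphic S S.
Proof. by exists id; split=> //; apply: isomorphism_refl. Qed.

Lemma rooted_isomorphic_sym (S T : rooted) : rooted_isomorphic S T -> rooted_isomorphic T S.
Proof.
move=> [f [fi f1 f2]]; have [[g fK gK] _ _] := fi.
by exists g; rewrite -f1 -f2 !fK; split=> //; apply: isomorphism_inv fi fK gK.
Qed.

Lemma finite_representatives (P : rooted -> Prop) (F : finType) (code : rooted -> F) :
  (forall S T : rooted, P S -> P T -> code S = code T -> rooted_isomorphic S T) ->
  exists N (t : 'I_N -> rooted), [/\ forall i, P (t i),
    forall T, P T -> exists i, rooted_isomorphic (t i) T &
    forall i j, rooted_isomorphic (t i) (t j) -> i = j].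
Proof.
move=> codeP.
suff H (s : seq F) : exists N (t : 'I_N -> rooted), [/\ forall i, P (t i),
    forall T, P T -> code T \in s -> exists i, rooted_isomorphic (t i) T &
    forall i j, rooted_isomorphic (t i) (t j) -> i = j].
  have [N [t [t1 t2 t3]]] := H (enum F); exists N, t; split=> // T PT.
  by apply: t2 => //; rewrite mem_enum.
elim: s => [|c s [N [t [t1 t2 t3]]]].
  exists 0, (fun i : 'I_0 => match notF (ltn_ord i) with end).
  by split=> // -[].
have [[T [PT cT nT]]|no] := Classical_Prop.classic (exists T, [/\ P T, code T = c &
    forall i, ~ rooted_isomorphic (t i) T]); last first.
  exists N, t; split=> // T PT; rewrite inE => /orP[/eqP cT|]; last exact: t2.
  apply: Classical_Prop.NNPP => h; apply: no; exists T; split=> // i hi; apply: h.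
  by exists i.
exists N.+1, (fun i => if unlift ord0 i is Some j then t j else T); split.
- by move=> i; case: unliftP.
- move=> S PS; rewrite inE => /orP[/eqP cS|cS].
    by exists ord0; rewrite unlift_none; apply: codeP => //; rewrite cT.
  by have [i hi] := t2 S PS cS; exists (lift ord0 i); rewrite liftK.
- move=> i j; case: unliftP => [i'|] ->; case: unliftP => [j'|] -> //.
  + by move=> /t3 ->.
  + by move=> /nT.
  + by move/rooted_isomorphic_sym/nT.
Qed.

Definition rank11 (T : finType) (x : T) : 'I_11 := inord (enum_rank x).

Definition decide_prop (P : Prop) : bool := ClassicalEpsilon.excluded_middle_informative P.

Lemma decide_propP (P : Prop) : reflect P (decide_prop P).
Proof. by rewrite /decide_prop; case: ClassicalEpsilon.excluded_middle_informative => h; constructor. Qed.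

Definition usym_of (o : option (option 'I_4)) : usym :=
  match o with None => R_l | Some None => R_r | Some (Some i) => R_K i end.

Definition bsym_of (o : option bool) : bsym :=
  match o with None => R_E0 | Some true => R_E1 | Some false => R_le end.

Definition rooted_code (T : rooted) :=
  (inord #|T| : 'I_11, (rank11 (root1 T), rank11 (root2 T)),
   [ffun p : option (option 'I_4) * 'I_11 =>
     [exists x : T, (rank11 x == p.2) && decide_prop (@unR lang1 T (usym_of p.1) x)]],
   [ffun p : option bool * 'I_11 * 'I_11 =>
     [exists x : T, [exists y : T, [&& rank11 x == p.1.2, rank11 y == p.2 &
       decide_prop (@binR lang1 T (bsym_of p.1.1) x y)]]]]).

Lemma rooted_codeP (S T : rooted) : #|S| <= 10 -> #|T| <= 10 ->
  rooted_code S = rooted_code T -> rooted_isomorphic S T.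
Proof.
move=> cS cT [E r1 r2 /ffunP U /ffunP B].
have {}E : #|S| = #|T|.
  by have := congr1 val E; rewrite /= !inordK.
have vr (X : rooted) (x : X) : #|X| <= 10 -> rank11 x = enum_rank x :> nat.
  by move=> cX; rewrite inordK //; apply: leq_trans (ltn_ord _) (leqW cX).
have rinj (X : rooted) : #|X| <= 10 -> injective (@rank11 X).
  move=> cX x y /(congr1 val) /=; rewrite -!/(rank11 _) !vr // => /val_inj.
  exact: enum_rank_inj.
pose f (x : S) : T := enum_val (cast_ord E (enum_rank x)).
pose g (x : T) : S := enum_val (cast_ord (esym E) (enum_rank x)).
have fK : cancel f g by move=> x; rewrite /f /g enum_valK cast_ordK enum_rankK.
have gK : cancel g f by move=> x; rewrite /f /g enum_valK cast_ordKV enum_rankK.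
have rf x : rank11 (f x) = rank11 x.
  by apply: val_inj; rewrite /= -!/(rank11 _) !vr // /f enum_valK.
exists f; split; last 2 first.
- by apply: (rinj T) => //; rewrite rf.
- by apply: (rinj T) => //; rewrite rf.
split; first by exists g.
- move=> s x.
  have [o ->] : exists o, s = usym_of o.
    by case: s => [||i]; [exists None | exists (Some None) | exists (Some (Some i))].
  have := U (o, rank11 x); rewrite !ffunE /= => {}U; split=> h.
    match type of U with ?l = _ => have : l end.
      by apply/existsP; exists x; rewrite eqxx; apply/decide_propP.
    rewrite U => /existsP[y /andP[/eqP ry /decide_propP]].
    by rewrite -rf in ry; rewrite (rinj T cT _ _ ry).
  match type of U with _ = ?l => have : l end.
    by apply/existsP; exists (f x); rewrite rf eqxx; apply/decide_propP.
  rewrite -U => /existsP[y /andP[/eqP ry /decide_propP]].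
  by rewrite (rinj S cS _ _ ry).
- move=> s x x'.
  have [o ->] : exists o, s = bsym_of o.
    by case: s; [exists None | exists (Some true) | exists (Some false)].
  have := B (o, rank11 x, rank11 x'); rewrite !ffunE /= => {}B; split=> h.
    match type of B with ?l = _ => have : l end.
      by apply/existsP; exists x; apply/existsP; exists x'; rewrite !eqxx; apply/decide_propP.
    rewrite B => /existsP[y /existsP[y' /and3P[/eqP ry /eqP ry' /decide_propP]]].
    rewrite -rf in ry; rewrite -rf in ry'.
    by rewrite (rinj T cT _ _ ry) (rinj T cT _ _ ry').
  match type of B with _ = ?l => have : l end.
    by apply/existsP; exists (f x); apply/existsP; exists (f x'); rewrite !rf !eqxx; apply/decide_propP.
  rewrite -B => /existsP[y /existsP[y' /and3P[/eqP ry /eqP ry' /decide_propP]]].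
  by rewrite (rinj S cS _ _ ry) (rinj S cS _ _ ry').
Qed.

Lemma card_pair_type (G : ordered_good_graph) (u v : G) : #|pair_type u v| <= 10.
Proof.
rewrite /= card_sig.
have c w : #|centre (@edge G) w| <= 4.
  by apply: card_centre; [apply: edge_sym|apply: edge_irr|apply: edge_bowtie_free].
rewrite -[10]/(2 + 4 + 4).
apply: leq_trans (leq_card_setU _ _) (leq_add _ (c v)).
apply: leq_trans (leq_card_setU _ _) (leq_add _ (c u)).
by rewrite cards2; case: (_ != _).
Qed.

Lemma type_enumeration_exists :
  exists N (t : 'I_N -> rooted), type_enumeration t.
Proof.
have [|N [t [t1 t2 t3]]] := @finite_representatives (fun T => exists (G : ordered_good_graph) (u v : G), u != v /\ T = pair_type u v) _ rooted_code.
  move=> S T [G [u [v [_ ->]]]] [G' [u' [v' [_ ->]]]].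
  by apply: rooted_codeP; apply: card_pair_type.
exists N, t; split=> //.
- move=> i; have [G [u [v [uv E]]]] := t1 i; exists G, u, v; split=> //.
  by rewrite E; apply: rooted_isomorphic_refl.
- by move=> G u v uv; apply: t2; exists G, u, v.
Qed.

Definition lang2 (N : nat) : lang := Lang usym (bsym + 'I_N).

Definition L2 (N : nat) (t : 'I_N -> rooted) (G : ordered_good_graph) :
    structure (lang2 N) :=
  @Structure (lang2 N) G (@unR lang1 (L1 G))
    (fun s x y =>
       match s with
       | inl s0 => @binR lang1 (L1 G) s0 x y
       | inr i => vlt x y /\ rooted_isomorphic (t i) (pair_type x y)
       end).

Definition B2 (N : nat) (t : 'I_N -> rooted) (M : structure (lang2 N)) : Prop :=
  exists G : ordered_good_graph, isomorphic M (L2 t G).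

Definition Bbar (N : nat) (t : 'I_N -> rooted) (M : structure (lang2 N)) :
    Prop :=
  exists2 H : structure (lang2 N), B2 t H &
  exists S : {set H}, isomorphic M (induced S).

(* Main.v *)
Require Import Defs.
From mathcomp Require Import all_boot zify.

Set Implicit Arguments.
Unset Strict Implicit.
Unset Printing Implicit Defensive.

(** In a bowtie-free graph two triangles that share a vertex share an edge.
    Hence in a good graph every component of (V, E_0) is a chimney or a K4,
    called a block below, and no triangle meets two blocks. A good graph is
    therefore a set of blocks together with further edges E_1 between
    different blocks, subject only to the rule that no triangle contains an edge
    of E_1. Four unary maps [F 0], .., [F 3] that send a vertex to the vertices
    of its centre, and a labelling of the vertices by their place in the block,
    describe the blocks ([frame], [decoration_exists]).

    The type of a pair shows how the centres of both vertices lie to each other.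
    So an embedding of lifts [L2] extends to the closure under the maps [F k]
    of its domain ([closure_copy]). If [B] sits in the good graph [G], colouring the
    copies of [A] thus becomes colouring the copies of a closed subset of [G],
    and the theorem reduces to [good_graph_ramsey].

    The latter is a partite construction of Nesetril and Rodl for structures
    with unary maps and one binary relation ([partite_construction]), based on
    the Hales-Jewett theorem. It is used twice ([ordered_ramsey]). The first use
    starts from a base of numbered points, where Ramsey's theorem for finite
    sets applies ([numbering_ramsey]), and takes care of the relation E_1. It
    gives no control over triangles. The second use takes the outcome of the
    first as its base and the complete graph as its relation. The relation then
    singles out pairs that stem from copies of [G], and each of its triangles
    projects into a copy of [G] in the first outcome ([amalgam_triangle]); on these pairs E_1 is read off from the first outcome,
    so that no triangle contains an edge of E_1.

    In the result only the vertices that lie on copies of [G] are retained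
    ([covered]). They inherit from [G] all laws that concern a single block, so
    they form a good graph. A lexicographic order by kind, number of the block,
    and number of the vertex is admissible and extends the order of every copy
    ([block_order]). *)

(** * The Hales-Jewett theorem *)

(** A combinatorial line is a word over the alphabet extended by [None], the
    moving letter, which has to occur. *)
Definition is_line (I T : finType) (w : {ffun I -> option T}) : bool :=
  [exists i, w i == None].

Definition word_at (I T : finType) (w : {ffun I -> option T}) (t : T) :
    {ffun I -> T} := [ffun i => odflt t (w i)].

Definition concat (I J : finType) (T : Type) (u : {ffun I -> T})
    (v : {ffun J -> T}) : {ffun I + J -> T} :=
  [ffun i => match i with inl i => u i | inr j => v j end].

Lemma word_at_concat (I J T : finType) (w : {ffun I -> option T})
    (w' : {ffun J -> option T}) t :
  word_at (concat w w') t = concat (word_at w t) (word_at w' t).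
Proof. by apply/ffunP=> -[i|j]; rewrite !ffunE. Qed.

Lemma is_line_concat (I J T : finType) (w : {ffun I -> option T})
    (w' : {ffun J -> option T}) :
  is_line (concat w w') = is_line w || is_line w'.
Proof.
apply/existsP/orP=> [[[i|j]]|[/existsP[i wi]|/existsP[j wj]]]; rewrite ?ffunE.
- by move=> wi; left; apply/existsP; exists i.
- by move=> wj; right; apply/existsP; exists j.
- by exists (inl i); rewrite ffunE.
- by exists (inr j); rewrite ffunE.
Qed.

Definition const_word (I : finType) (T : finType) (u : {ffun I -> T}) :
  {ffun I -> option T} := [ffun i => Some (u i)].

Lemma word_at_const (I T : finType) (u : {ffun I -> T}) t :
  word_at (const_word u) t = u.
Proof. by apply/ffunP=> i; rewrite !ffunE. Qed.

Section HalesJewett.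

Variable T : finType.

Definition monochromatic_on (I : finType) (C : Type) (S : seq T)
    (chi : {ffun I -> T} -> C) (w : {ffun I -> option T}) : Prop :=
  {in S &, forall t t', chi (word_at w t) = chi (word_at w t')}.

(** The lines in [ws] meet in the point [f] at the letter [a], and on the letters
    of [S] they have pairwise different colours. *)
Definition focused (C : finType) (I : finType) (a : T) (S : seq T)
    (chi : {ffun I -> T} -> C) (f : {ffun I -> T})
    (ws : seq ({ffun I -> option T} * C)) : Prop :=
  uniq (unzip2 ws) /\
  {in ws, forall p, [/\ is_line p.1, word_at p.1 a = f &
                       {in S, forall t, chi (word_at p.1 t) = p.2}]}.

(** Induction on the set [S] of letters on which the line has to be
    monochromatic; the words range over the whole alphabet [T] throughout, so no
    change of alphabet occurs. The step is colour focusing: as long as no line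
    monochromatic on [a :: S] appears, one more block of coordinates adds a line
    of a new colour to the family focused at one point, and the number of
    colours bounds the size of that family. *)
Lemma hales_jewett_on (S : seq T) (C : finType) :
  exists I : finType, forall chi : {ffun I -> T} -> C,
  exists2 w, is_line w & monochromatic_on S chi w.
Proof.
have diag (a : T) (S' : seq T) D (chi : {ffun unit -> T} -> D) :
    {subset S' <= [:: a]} ->
    exists2 w, is_line w & monochromatic_on S' chi w.
  move=> sub; exists [ffun=> None]; first by apply/existsP; exists tt; rewrite ffunE.
  by move=> t t' /sub + /sub; rewrite !inE => /eqP-> /eqP->.
elim: S C => [|a S IH] C.
  exists unit => chi; exists [ffun=> None] => //.
  by apply/existsP; exists tt; rewrite ffunE.
case: S IH => [_|s0 S' IH].
  by exists unit => chi; apply: (diag a).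
set S := s0 :: S' in IH *.
have s0S : s0 \in S by rewrite inE eqxx.
suff key r : exists I : finType, forall chi : {ffun I -> T} -> C,
    (exists f ws, focused a S chi f ws /\ size ws = r) \/
    (exists2 w, is_line w & monochromatic_on (a :: S) chi w).
  have [I HI] := key #|C|.+1; exists I => chi.
  case: (HI chi) => // -[f [ws [[u _] sz]]].
  by move/card_uniqP: u (max_card [in unzip2 ws]) => ->; rewrite size_map sz ltnn.
elim: r => [|r [I HI]].
  exists void => chi; left; exists [ffun x : void => match x with end], [::].
  by split.
(* The colours on the second block are colourings of the first block, so that
   one line there serves all words of the first block. *)
have [J HJ] := IH {ffun {ffun I -> T} -> C}.
exists (I + J)%type => chi.
have [w' lw' mw'] := HJ (fun v => [ffun u => chi (concat u v)]).
have {}mw' t u : t \in S ->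
    chi (concat u (word_at w' t)) = chi (concat u (word_at w' s0)).
  by move=> tS; have /ffunP/(_ u) := mw' t s0 tS s0S; rewrite !ffunE.
pose chi0 u := chi (concat u (word_at w' s0)).
have lift_mono w : is_line w -> monochromatic_on (a :: S) chi0 w ->
    exists2 w, is_line w & monochromatic_on (a :: S) chi w.
  move=> lw mw; exists (concat w (const_word (word_at w' s0))).
    by rewrite is_line_concat lw.
  by move=> t t' tS t'S; rewrite !word_at_concat !word_at_const; apply: mw.
case: (HI chi0) => [[f [ws [[u H] sz]]]|[w lw mw]]; last first.
  by right; apply: lift_mono mw.
have [/mapP[[w c] wsw /= ec]|new] := boolP (chi0 f \in unzip2 ws).
  have [/= lw wf mw] := H _ wsw; right; apply: (lift_mono w) => // t t'.
  have at_c t1 : t1 \in a :: S -> chi0 (word_at w t1) = c.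
    by rewrite inE => /orP[/eqP->|tS]; [rewrite wf | exact: mw].
  by move=> /at_c-> /at_c->.
left; exists (concat f (word_at w' a)).
exists ((concat (const_word f) w', chi0 f) ::
        [seq (concat p.1 w', p.2) | p <- ws]); split; last first.
  by rewrite /= size_map sz.
split.
  by rewrite /= /unzip2 -map_comp (eq_map (_ : _ =1 snd)) // new.
move=> p; rewrite inE => /orP[/eqP->|/mapP[[w c] wsw ->]] /=.
  split; first by rewrite is_line_concat lw' orbT.
    by rewrite word_at_concat word_at_const.
  by move=> t tS; rewrite word_at_concat word_at_const mw'.
have [/= lw wf mw] := H _ wsw; split; first by rewrite is_line_concat lw.
  by rewrite word_at_concat wf.
by move=> t tS; rewrite word_at_concat mw' // -(mw t tS).
Qed.

Theorem hales_jewett (C : finType) :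
  exists I : finType, forall chi : {ffun I -> T} -> C,
  exists2 w, is_line w &
    forall t t', chi (word_at w t) = chi (word_at w t').
Proof.
have [I HI] := hales_jewett_on (enum T) C; exists I => chi.
by have [w lw mw] := HI chi; exists w => // t t'; apply: mw; rewrite mem_enum.
Qed.

End HalesJewett.

(** * Ramsey's theorem *)
Lemma size_count_fibres (T : Type) (C : finType) (col : T -> C) (s : seq T) :
  size s = \sum_c count (fun x => col x == c) s.
Proof.
elim: s => [|x s IH] /=; first by rewrite big1.
rewrite big_split /= -IH (bigD1 (col x)) //= eqxx big1 ?addn0 //.
by move=> c; rewrite eq_sym => /negPf->.
Qed.

Lemma pigeonhole_seq (T : Type) (C : finType) (M : nat) (col : T -> C) (s : seq T) :
  #|C| * M < size s -> exists c, M <= count (fun x => col x == c) s.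
Proof.
move=> big; apply/existsP; apply: contraLR big; rewrite negb_exists -leqNgt.
move=> /forallP small; rewrite (size_count_fibres col) -sum_nat_const.
by apply: leq_sum => c _; have := small c; rewrite -ltnNge => /ltnW.
Qed.

(** Ramsey's theorem for [m]-subsets, with subsequences in the role of subsets.
    As usual, one first finds a long subsequence on which the colour depends only
    on the first entry, and then applies the pigeonhole principle. *)
Theorem ramsey_subseq (T : eqType) (C : finType) (c0 : C) (m M : nat) :
  exists n, forall (S : seq T) (chi : seq T -> C), n <= size S ->
  exists s c, [/\ subseq s S, size s = M &
    forall t, subseq t s -> size t = m -> chi t = c].
Proof.
elim: m M => [|m IH] M.
  exists M => S chi szS; exists (take M S), (chi [::]); split.
  - exact: take_subseq.
  - by rewrite size_takel.
  - by move=> t _ /size0nil->.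
have {IH} end_hom L : exists n, forall (S : seq T) (chi : seq T -> C), n <= size S ->
  exists s col, [/\ subseq s S, size s = L &
    forall x t, subseq (x :: t) s -> size t = m -> chi (x :: t) = col x].
  elim: L => [|L [n Hn]].
    exists 0 => S chi _; exists [::], (fun=> c0); split=> //; exact: sub0seq.
  have [n' Hn'] := IH n; exists n'.+1 => -[//|x S] chi szS.
  have [S1 [c [sub1 sz1 H1]]] := Hn' S (fun t => chi (x :: t)) szS.
  have [|s [col [sub sz H]]] := Hn S1 chi; first by rewrite sz1.
  exists (x :: s), (fun y => if y == x then c else col y); split.
  - by rewrite /= eqxx; apply: subseq_trans sub1.
  - by rewrite /= sz.
  move=> y t; rewrite /=; have [-> ts|_] := eqVneq y x; last exact: H.
  by apply: H1; apply: subseq_trans sub.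
have [n Hn] := end_hom (#|C| * M).+1; exists n => S chi szS.
have [s [col [sub sz H]]] := Hn S chi szS.
have [c hc] : exists c, M <= count (fun x => col x == c) s.
  by apply: pigeonhole_seq; rewrite sz.
exists (take M [seq x <- s | col x == c]), c; split.
- apply: subseq_trans (take_subseq _ _) _.
  exact: subseq_trans (filter_subseq _ _) sub.
- by rewrite size_takel // size_filter.
move=> [//|x t] xt [szt].
have {}xt : subseq (x :: t) [seq x <- s | col x == c].
  exact: subseq_trans xt (take_subseq _ _).
rewrite H //; last exact: subseq_trans xt (filter_subseq _ _).
have : x \in [seq x <- s | col x == c] by apply: (mem_subseq xt); rewrite inE eqxx.
by rewrite mem_filter => /andP[/eqP].
Qed.

(** * Partite construction *)

Definition ffun_comp (S : finType) (T U : Type) (g : T -> U) (f : {ffun S -> T}) :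
  {ffun S -> U} := [ffun s => g (f s)].

Definition equivariant (K : finType) (X Y : Type) (FX : K -> X -> X)
    (FY : K -> Y -> Y) (f : X -> Y) : Prop :=
  forall k x, f (FX k x) = FY k (f x).

Section Systems.

Variables (K D : finType) (FD : K -> D -> D).

(** A partite structure over the base [D]: [proj] gives the part of a point, and
    the unary maps of the structure commute with it. *)
Record system := System {
  point :> finType;
  proj : point -> D;
  act : K -> point -> point;
  adj : rel point;
  proj_act : equivariant act FD proj }.

(** Injectivity is not demanded: what is transported along such maps are lifts
    of injective maps into [D], and these are injective anyway. *)
Record system_embedding (P Q : system) (f : P -> Q) : Prop := SystemEmbedding {
  emb_proj : forall x, proj (f x) = proj x;
  emb_act : equivariant (@act P) (@act Q) f;
  emb_adj : forall x y, adj (f x) (f y) = adj x y }.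

Definition triangle (P : system) (x y z : P) : bool :=
  [&& adj x y, adj x z & adj y z].

Definition triangles_descend (Q P : system) : Prop :=
  forall u v t : Q, triangle u v t -> exists x y z : P,
  [/\ triangle x y z, proj x = proj u, proj y = proj v & proj z = proj t].

Section Lifts.

Variables (A : finType) (FA : K -> A -> A) (EA : rel A).

(** A copy of [A] in [P] that lies over the copy [a] of [A] in the base. *)
Definition is_lift (P : system) (a : {ffun A -> D}) (l : {ffun A -> P}) : bool :=
  [&& [forall s, proj (l s) == a s],
      [forall k, forall s, l (FA k s) == act k (l s)] &
      [forall s, forall s', adj (l s) (l s') == EA s s']].

Lemma liftP (P : system) (a : {ffun A -> D}) (l : {ffun A -> P}) :
  reflect [/\ forall s, proj (l s) = a s, equivariant FA (@act P) l &
              forall s s', adj (l s) (l s') = EA s s'] (is_lift a l).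
Proof.
apply: (iffP and3P) => [[/forallP l1 /'forall_forallP l2 /'forall_forallP l3]|[l1 l2 l3]].
  by split=> [s|k s|s s']; apply/eqP.
split; first by apply/forallP=> s; apply/eqP.
  by apply/'forall_forallP=> k s; apply/eqP.
by apply/'forall_forallP=> s s'; apply/eqP.
Qed.

Lemma lift_embedding (P Q : system) (f : P -> Q) (a : {ffun A -> D})
    (l : {ffun A -> P}) :
  system_embedding f -> is_lift a l -> is_lift a (ffun_comp f l).
Proof.
move=> [f1 f2 f3] /liftP[l1 l2 l3]; apply/liftP; split=> [s|k s|s s'].
- by rewrite ffunE f1.
- by rewrite !ffunE l2 f2.
- by rewrite !ffunE f3.
Qed.

End Lifts.

(** One step of the construction: for one copy [a] of [A] in the base, a system
    in which every colouring admits a copy of [P] whose lifts of [a] all have one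
    colour. The letters are the lifts of [a] to [P]. The power [I -> P] contains,
    for each line over this alphabet, a copy of the part of [P] above [a]; each of
    these copies is completed to a copy of [P] by points [(w, x)]. *)
Section PartiteStep.

Variables (A : finType) (FA : K -> A -> A) (EA : rel A).
Variables (P : system) (a : {ffun A -> D}).
Hypotheses (a_inj : injective a) (a_act : equivariant FA FD a).

Let letter : finType := {l : {ffun A -> P} | is_lift FA EA a l}.

Variable I : finType.
Variable i0 : I.

Let line : finType := {ffun I -> option letter}.
Let tuples : finType := {ffun I -> P}.

Definition fibre (x : D) : option A := [pick s | a s == x].

Lemma fibre_some x s : fibre x = Some s -> a s = x.
Proof. by rewrite /fibre; case: pickP => // s' /eqP e [<-]. Qed.

Lemma fibreK s : fibre (a s) = Some s.
Proof.
rewrite /fibre; case: pickP => [s' /eqP /a_inj -> //|/(_ s)].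
by rewrite eqxx.
Qed.

(** At a fixed coordinate the point above [a s] is replaced by the point above
    [a s] of the fixed lift; at a moving one it is kept. *)
Definition line_point (w : line) (x : P) (s : A) : tuples :=
  [ffun i => if w i is Some l then val l s else x].

Definition spread (w : line) (x : P) : tuples + line * P :=
  if fibre (proj x) is Some s then inl (line_point w x s) else inr (w, x).

(** Between the parts above [a s] and [a s'] the relation of [P] agrees with
    [EA s s'] at all fixed coordinates of a line. So if [EA s s'] holds, the
    relation at the moving coordinates is recovered by requiring it at all
    coordinates, and otherwise by requiring it at some coordinate. The negated
    form makes all parts compatible if [EA] is complete. *)
Definition compatible (d d' : D) : bool :=
  ~~ [exists s, exists s', [&& a s == d, a s' == d' & ~~ EA s s']].

Definition amalgam_proj (u : tuples + line * P) : D :=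
  match u with inl x => proj (x i0) | inr (w, x) => proj x end.

Definition amalgam_act (k : K) (u : tuples + line * P) : tuples + line * P :=
  match u with
  | inl x => inl [ffun i => act k (x i)]
  | inr (w, x) => spread w (act k x)
  end.

Definition glued_adj : rel (tuples + line * P) := fun u v =>
  [exists w : line, exists x : P, exists y : P,
    [&& is_line w, spread w x == u, spread w y == v & adj x y]].

(** Free amalgamation: outside of the power, two points are related only if some
    copy of [P] says so. *)
Definition amalgam_adj : rel (tuples + line * P) := fun u v =>
  match u, v with
  | inl x, inl y =>
    if compatible (proj (x i0)) (proj (y i0))
    then [forall i, adj (x i) (y i)] else [exists i, adj (x i) (y i)]
  | _, _ => glued_adj u v
  end.

Lemma proj_spread w x : amalgam_proj (spread w x) = proj x.
Proof.
rewrite /spread; case E: (fibre _) => [s|] //=; rewrite ffunE.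
case: (w i0) => [[l /=/liftP[l1 _ _]]|//]; by rewrite l1 (fibre_some E).
Qed.

Lemma amalgam_proj_act : equivariant amalgam_act FD amalgam_proj.
Proof.
move=> k [x|[w x]] /=; first by rewrite ffunE proj_act.
by rewrite proj_spread proj_act.
Qed.

Definition amalgam : system := System amalgam_adj amalgam_proj_act.

Lemma spread_act w : equivariant (@act P) (@act amalgam) (spread w).
Proof.
move=> k x; rewrite {2}/spread; case E: (fibre _) => [s|] //=.
rewrite /spread proj_act -(fibre_some E) -a_act fibreK; congr inl.
apply/ffunP=> i; rewrite !ffunE; case: (w i) => [[l /=/liftP[_ l2 _]]|//].
exact: l2.
Qed.

Lemma spread_inj w : is_line w -> injective (spread w).
Proof.
move=> /existsP[i /eqP wi] x y; rewrite /spread.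
case: (fibre _) => [s|]; case: (fibre _) => [s'|] // [].
  by move/ffunP/(_ i); rewrite !ffunE wi.
by [].
Qed.

Lemma spread_inr w x w' y : spread w x = inr (w', y) -> w = w' /\ x = y.
Proof. by rewrite /spread; case: (fibre _) => // -[-> ->]. Qed.

Lemma compatible_fibre s s' : compatible (a s) (a s') = EA s s'.
Proof.
rewrite /compatible; apply/idP/idP=> [|E].
  apply: contraNT => nE; apply/existsP; exists s; apply/existsP; exists s'.
  by rewrite !eqxx.
by apply/existsP=> -[t /existsP[t' /and3P[/eqP/a_inj-> /eqP/a_inj->]]]; rewrite E.
Qed.

(** A line with a moving letter gives an injective map, so a pair of points in
    the image determines the pair it comes from; and a point [(w, x)] determines
    the line. *)
Lemma spread_adj w x y : is_line w ->
  amalgam_adj (spread w x) (spread w y) = adj x y.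
Proof.
move=> lw; have glued u v : 
    glued_adj u v ->
    (exists z, u = inr z) \/ (exists z, v = inr z) ->
    u = spread w x -> v = spread w y -> adj x y.
  move=> /existsP[w' /existsP[x' /existsP[y' /and4P[_ /eqP <- /eqP <- xy]]]] h ex ey.
  have E : w' = w.
    case: h => -[[w1 z]] h.
      by have [-> _] := spread_inr h; rewrite h in ex; have [-> _] := spread_inr (esym ex).
    by have [-> _] := spread_inr h; rewrite h in ey; have [-> _] := spread_inr (esym ey).
  by rewrite E in ex ey; rewrite -(spread_inj lw ex) -(spread_inj lw ey).
have glue u v : u = spread w x -> v = spread w y -> adj x y ->
    glued_adj u v.
  move=> -> -> xy; apply/existsP; exists w; apply/existsP; exists x.
  by apply/existsP; exists y; rewrite lw !eqxx.
rewrite /amalgam_adj.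
case Ex: (spread w x) => [u|u]; case Ey: (spread w y) => [v|v]; last first.
- by apply/idP/idP=> [/glued|]; [apply=> //; left; exists u | apply: glue].
- by apply/idP/idP=> [/glued|]; [apply=> //; left; exists u | apply: glue].
- by apply/idP/idP=> [/glued|]; [apply=> //; right; exists v | apply: glue].
rewrite (_ : proj (u i0) = proj x); last by rewrite -(proj_spread w x) Ex.
rewrite (_ : proj (v i0) = proj y); last by rewrite -(proj_spread w y) Ey.
move: Ex Ey; rewrite /spread.
case Es: (fibre _) => [s|] // [<-]; case Es': (fibre _) => [s'|] // [<-].
rewrite -(fibre_some Es) -(fibre_some Es') compatible_fibre.
have [i1 /eqP wi1] := existsP lw.
case EAs: (EA s s').
  apply/forallP/idP=> [/(_ i1)|xy i]; rewrite !ffunE ?wi1 //.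
  by case: (w i) => [[l /=/liftP[_ _ ->]]|].
apply/existsP/idP=> [[i]|xy]; last by exists i1; rewrite !ffunE wi1.
by rewrite !ffunE; case: (w i) => [[l /=/liftP[_ _ ->]]|]; rewrite ?EAs.
Qed.

Lemma spread_embedding w : is_line w -> @system_embedding P amalgam (spread w).
Proof.
move=> lw; split=> [x||x y]; [exact: proj_spread|exact: spread_act|].
exact: spread_adj.
Qed.

Lemma adj_inr w x v : amalgam_adj (inr (w, x)) v \/ amalgam_adj v (inr (w, x)) ->
  [/\ is_line w, inr (w, x) = spread w x & exists y, v = spread w y].
Proof.
have H u1 u2 : glued_adj u1 u2 ->
    exists w' x' y', [/\ is_line w', u1 = spread w' x' & u2 = spread w' y'].
  move=> /existsP[w' /existsP[x' /existsP[y' /and4P[lw /eqP e1 /eqP e2 _]]]].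
  by exists w', x', y'.
have -> : amalgam_adj v (inr (w, x)) = glued_adj v (inr (w, x)) by case: v.
case=> /H[w' [x' [y' [lw]]]].
  by move=> e1 ->; have [? ?] := spread_inr (esym e1); subst; split=> //; exists y'.
by move=> -> e1; have [? ?] := spread_inr (esym e1); subst; split=> //; exists x'.
Qed.

(** With [EA] complete the relation on the power is the product relation, which
    projects to any coordinate; and a triangle that leaves the power lies in a
    single copy of [P], since the amalgamation is free. *)
Lemma amalgam_triangle : (forall s s', EA s s') -> triangles_descend amalgam P.
Proof.
move=> EAT u v t /and3P[uv ut vt].
have C d d' : compatible d d'.
  by apply/existsPn=> s; apply/existsPn=> s'; rewrite EAT !andbF.
have on_line w x y z : is_line w -> u = spread w x -> v = spread w y -> t = spread w z ->
    exists x y z : P,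
    [/\ triangle x y z, proj x = proj u, proj y = proj v & proj z = proj t].
  move=> lw eu ev et; exists x, y, z; move: uv ut vt; rewrite eu ev et /= !spread_adj //.
  by move=> xy xz yz; rewrite !proj_spread /triangle xy xz yz.
case: u uv ut on_line => [u|[w x]] uv ut on_line; last first.
  have [lw eu [y ey]] := adj_inr (or_introl uv).
  have [_ _ [z ez]] := adj_inr (or_introl ut).
  exact: (on_line w x y z).
case: v uv vt on_line => [v|[w y]] uv vt on_line; last first.
  have [lw ev [x ex]] := adj_inr (or_intror uv).
  have [_ _ [z ez]] := adj_inr (or_introl vt).
  exact: (on_line w x y z).
case: t ut vt on_line => [t|[w z]] ut vt on_line; last first.
  have [lw et [x ex]] := adj_inr (or_intror ut).
  have [_ _ [y ey]] := adj_inr (or_intror vt).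
  exact: (on_line w x y z).
move: uv ut vt => /=; rewrite !C.
move=> /forallP/(_ i0) uv /forallP/(_ i0) ut /forallP/(_ i0) vt.
by exists (u i0), (v i0), (t i0); split=> //; apply/and3P.
Qed.

(** A word over the lifts of [a] is a lift of [a] to the power, and the images of
    the lifts of [a] under the copy of [P] given by a line are the words of this
    line. *)
Lemma amalgam_monochromatic (C : Type) (chi : {ffun A -> amalgam} -> C) :
  (forall chi' : {ffun I -> letter} -> C, exists2 w, is_line w &
    forall l l', chi' (word_at w l) = chi' (word_at w l')) ->
  exists2 f : P -> amalgam, system_embedding f &
  forall l l', is_lift FA EA a l -> is_lift FA EA a l' ->
    chi (ffun_comp f l) = chi (ffun_comp f l').
Proof.
pose trace (u : {ffun I -> letter}) : {ffun A -> amalgam} :=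
  [ffun s => inl [ffun i => val (u i) s]].
move=> /(_ (chi \o trace))[w lw mono].
exists (spread w); first exact: spread_embedding.
have spread_word l (hl : is_lift FA EA a l) :
    ffun_comp (spread w) l = trace (word_at w (exist _ l hl)).
  apply/ffunP=> s; rewrite !ffunE /spread.
  have [l1 _ _] := liftP _ _ _ _ hl; rewrite l1 fibreK; congr inl.
  by apply/ffunP=> i; rewrite !ffunE; case: (w i).
by move=> l l' hl hl'; rewrite (spread_word l hl) (spread_word l' hl'); apply: mono.
Qed.

End PartiteStep.

Section PartiteConstruction.

Variables (A : finType) (FA : K -> A -> A) (EA : rel A).

Lemma partite_step (C : finType) (P : system) (a : {ffun A -> D}) :
  injective a -> equivariant FA FD a ->
  exists Q : system,
    ((forall s s', EA s s') -> triangles_descend Q P) /\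
    forall chi : {ffun A -> Q} -> C,
    exists2 f : P -> Q, system_embedding f &
    forall l l', is_lift FA EA a l -> is_lift FA EA a l' ->
      chi (ffun_comp f l) = chi (ffun_comp f l').
Proof.
move=> a_inj a_act.
have [I HI] := hales_jewett {l : {ffun A -> P} | is_lift FA EA a l} C.
have [i0 _|noI] := pickP (@predT I); last first.
  exists P; split=> [_ u v t uvt|chi]; first by exists u, v, t.
  exists id; first by split.
  move=> l l' hl hl'.
  pose c0 (u : {ffun I -> {l : {ffun A -> P} | is_lift FA EA a l}}) := chi l.
  by have [w /existsP[i _]] := HI c0; have := noI i.
exists (amalgam FA EA P a i0); split; first exact: amalgam_triangle.
by move=> chi; apply: amalgam_monochromatic.
Qed.

Variables (B : finType) (FB : K -> B -> B) (EB : rel B).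

Definition triangles_from (bases : pred {ffun B -> D}) (P : system) : Prop :=
  forall x y z : P, triangle x y z ->
  exists b p q r, [/\ bases b, proj x = b p, proj y = b q & proj z = b r].

(** Start with the disjoint union of all copies of [B] over the base and treat
    the copies of [A] in the base one after another. In the end the colour of a
    copy of [A] in some copy of the disjoint union depends only on its projection,
    and the Ramsey property of the base applies. *)
Theorem partite_construction (C : finType) (c0 : C) (bases : pred {ffun B -> D})
    (copies : pred {ffun A -> B}) :
  {in bases, forall b : {ffun B -> D}, injective b /\ equivariant FB FD b} ->
  {in copies, forall c : {ffun A -> B}, [/\ injective c, equivariant FA FB c &
                           forall s s', EB (c s) (c s') = EA s s']} ->
  (forall chi : {ffun A -> D} -> C, exists2 b, b \in bases &
     {in copies &, forall c c', chi (ffun_comp b c) = chi (ffun_comp b c')}) ->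
  exists Q : system,
    ((forall s s', EA s s') -> triangles_from bases Q) /\
    forall chi : {ffun A -> Q} -> C,
    exists b l, [/\ b \in bases, is_lift FB EB b l &
      {in copies &, forall c c', chi (ffun_comp l c) = chi (ffun_comp l c')}].
Proof.
move=> basesP copiesP ramsey_base.
pose proj0 (u : {b | bases b} * B) := val u.1 u.2.
have proj0_act : equivariant (fun k u => (u.1, FB k u.2)) FD proj0.
  by move=> k [[b bb] p]; have [_] := basesP b bb; apply.
pose P0 := @System _ proj0 _ (fun u v => (u.1 == v.1) && EB u.2 v.2) proj0_act.
have step (L : seq {ffun A -> D}) :
    {in L, forall a : {ffun A -> D}, injective a /\ equivariant FA FD a} ->
    exists Q : system,
    ((forall s s', EA s s') -> triangles_from bases Q) /\
    forall chi : {ffun A -> Q} -> C,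
    exists2 f : P0 -> Q, system_embedding f &
    {in L, forall (a : {ffun A -> D}) l l', is_lift FA EA a l -> is_lift FA EA a l' ->
      chi (ffun_comp f l) = chi (ffun_comp f l')}.
  elim: L => [|a L IH] LP.
    exists P0; split=> [_|chi]; last by exists id.
    move=> [b p] [b' q] [b'' r] /and3P[/= /andP[/eqP/= <- _] /andP[/eqP/= <- _] _].
    by exists (val b), p, q, r; split=> //; apply: valP.
  have [|P [tri HP]] := IH; first by move=> a' a'L; apply: LP; rewrite inE a'L orbT.
  have [a_inj a_act] := LP a (mem_head _ _).
  have [Q [triQ HQ]] := partite_step C P a_inj a_act.
  exists Q; split=> [EAT|chi].
    move=> u v t /(triQ EAT)[x [y [z [xyz <- <- <-]]]]; exact: tri.
  have [f ef mono_a] := HQ chi.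
  have [g eg mono_L] := HP (fun l => chi (ffun_comp f l)).
  have compE (l : {ffun A -> P0}) : ffun_comp (f \o g) l = ffun_comp f (ffun_comp g l).
    by apply/ffunP=> s; rewrite !ffunE.
  exists (f \o g).
    case: ef eg => f1 f2 f3 [g1 g2 g3]; split=> [x|k x|x y] /=.
    - by rewrite f1.
    - by rewrite g2 f2.
    - by rewrite f3.
  move=> a'; rewrite inE => /orP[/eqP->|a'L] l l' hl hl'; rewrite !compE.
    by apply: mono_a; apply: lift_embedding eg _.
  exact: (mono_L a' a'L l l').
pose inj_act (a : {ffun A -> D}) :=
  injectiveb a && [forall k, forall s, a (FA k s) == FD k (a s)].
have [|Q [tri HQ]] := step (enum inj_act).
  move=> a; rewrite mem_enum => /andP[/injectiveP a_inj /'forall_forallP a_act].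
  by split=> // k s; apply/eqP.
exists Q; split=> // chi; have [f ef mono] := HQ chi.
(* The summand over [b] is a lift of [b]. *)
pose inst b (bb : bases b) : {ffun B -> P0} := [ffun p => (exist _ b bb, p)].
have inst_lift b (bb : bases b) : is_lift FB EB b (inst b bb).
  by apply/liftP; split=> [s|k s|s s']; rewrite !ffunE //= eqxx.
pose chi0 (a : {ffun A -> D}) : C :=
  if [pick l | is_lift FA EA a l] is Some l then chi (ffun_comp f l) else c0.
have [b bb mono_b] := ramsey_base chi0; exists b, (ffun_comp f (inst b bb)).
have [b_inj b_act] := basesP b bb.
have inst_copy c : c \in copies ->
    chi (ffun_comp (ffun_comp f (inst b bb)) c) = chi0 (ffun_comp b c).
  move=> cc; have [c_inj c_act c_adj] := copiesP c cc.
  have l_lift : is_lift FA EA (ffun_comp b c) (ffun_comp (inst b bb) c).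
    apply/liftP; split=> [s|k s|s s']; rewrite !ffunE //=; first by rewrite c_act.
    by rewrite eqxx c_adj.
  rewrite /chi0; case: pickP => [l hl|/(_ (ffun_comp (inst b bb) c))]; last first.
    by rewrite l_lift.
  have -> : ffun_comp (ffun_comp f (inst b bb)) c = ffun_comp f (ffun_comp (inst b bb) c).
    by apply/ffunP=> s; rewrite !ffunE.
  apply: (mono (ffun_comp b c)) => //.
  rewrite mem_enum; apply/andP; split.
    by apply/injectiveP=> s s'; rewrite !ffunE => /b_inj/c_inj.
  by apply/'forall_forallP=> k s; rewrite !ffunE c_act b_act.
split=> //; first exact: lift_embedding ef (inst_lift b bb).
by move=> c c' cc cc'; rewrite !inst_copy //; apply: mono_b.
Qed.

End PartiteConstruction.
End Systems.

(** * Ordered structures with unary maps *)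

Section OrderedRamsey.

Variables (K L : finType).

Definition act_opt (T : Type) (F : K -> T -> T) (o : option K) (x : T) : T :=
  if o is Some k then F k x else x.

(** A point is described by its label and number and by the labels and numbers
    of its images under all maps in [K]. If the maps satisfy [F k (F j x) = F k x],
    every numbering of the points is such a description, and commutes with
    the maps: [numbered] is the cofree structure. *)
Definition numbered (n : nat) : finType := {ffun option K -> L * 'I_n}.

Definition numbered_act (n : nat) (k : K) (d : numbered n) : numbered n :=
  [ffun o => d (Some (odflt k o))].

Definition numbering (n : nat) (T : finType) (F : K -> T -> T) (lab : T -> L)
    (h : T -> 'I_n) : {ffun T -> numbered n} :=
  [ffun x => [ffun o => (lab (act_opt F o x), h (act_opt F o x))]].

Definition root_number (n : nat) (d : numbered n) : 'I_n := (d None).2.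

Definition root_label (n : nat) (d : numbered n) : L := (d None).1.

Definition numberings (n : nat) (T : finType) (F : K -> T -> T) (lab : T -> L)
    (r : rel T) : pred {ffun T -> numbered n} := fun b =>
  [&& injectiveb b, [forall k, forall x, b (F k x) == numbered_act k (b x)],
      [forall x, root_label (b x) == lab x] &
      [forall x, forall y, strict_rel r x y ==> (root_number (b x) < root_number (b y))]].
Arguments numberings : clear implicits.
Arguments numberings n {T}.

Lemma numberingsP (n : nat) (T : finType) (F : K -> T -> T) (lab : T -> L)
    (r : rel T) (b : {ffun T -> numbered n}) :
  reflect [/\ injective b, equivariant F (@numbered_act n) b,
    forall x, root_label (b x) = lab x &
    forall x y, strict_rel r x y -> root_number (b x) < root_number (b y)]
  (numberings n F lab r b).
Proof.
apply: (iffP and4P).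
  move=> [/injectiveP h1 /'forall_forallP h2 /forallP h3 /'forall_forallP h4].
  split=> // [k x|x|x y]; [exact/eqP|exact/eqP|exact/implyP].
move=> [h1 h2 h3 h4]; split; first exact/injectiveP.
- by apply/'forall_forallP=> k x; apply/eqP.
- by apply/forallP=> x; apply/eqP.
by apply/'forall_forallP=> x y; apply/implyP/h4.
Qed.

Definition listing (T : finType) (r : rel T) : seq T := sort r (enum T).

Lemma mem_listing (T : finType) (r : rel T) x : x \in listing r.
Proof. by rewrite mem_sort mem_enum. Qed.

Lemma listing_uniq (T : finType) (r : rel T) : uniq (listing r).
Proof. by rewrite sort_uniq enum_uniq. Qed.

Lemma listing_sorted (T : finType) (r : rel T) : linear_order r -> sorted r (listing r).
Proof. by case=> _ _ _ tot; apply: sort_sorted. Qed.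

Lemma index_listing (T : finType) (r : rel T) x y : linear_order r ->
  strict_rel r x y -> index x (listing r) < index y (listing r).
Proof.
move=> lin /andP[ne xy]; have [rr ra rt _] := lin.
rewrite ltnNge; apply: contra ne => yx; apply/eqP; apply: ra; rewrite xy /=.
apply: (sorted_leq_index rt rr (listing_sorted lin)) => //; exact: mem_listing.
Qed.

Lemma numbering_numberings n (T : finType) (F : K -> T -> T) lab (r : rel T)
    (h : T -> 'I_n) :
  (forall k j x, F k (F j x) = F k x) -> injective h ->
  (forall x y, strict_rel r x y -> h x < h y) -> numberings n F lab r (numbering F lab h).
Proof.
move=> FF h_inj h_mono; apply/numberingsP; split.
- by move=> x y; rewrite !ffunE => /ffunP/(_ None); rewrite !ffunE => -[_ /h_inj].
- by move=> k x; apply/ffunP=> -[j|]; rewrite !ffunE /= ?FF.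
- by move=> x; rewrite /root_label !ffunE.
- by move=> x y xy; rewrite /root_number !ffunE; apply: h_mono.
Qed.

Variables (A B : finType) (FA : K -> A -> A) (FB : K -> B -> B).
Variables (labA : A -> L) (labB : B -> L) (rA : rel A) (rB : rel B).
Variables (EA : rel A) (EB : rel B).
Hypotheses (linA : linear_order rA) (linB : linear_order rB).
Hypothesis FBB : forall k j x, FB k (FB j x) = FB k x.

Record ordered_copy (c : {ffun A -> B}) : Prop := OrderedCopy {
  copy_inj : injective c;
  copy_act : equivariant FA FB c;
  copy_adj : forall s s', EB (c s) (c s') = EA s s';
  copy_lab : forall s, labB (c s) = labA s;
  copy_ord : {homo c : s s' / rA s s' >-> rB s s'} }.

(** Both sequences are sorted and without repetition. *)
Lemma listing_copy c : ordered_copy c -> subseq (map c (listing rA)) (listing rB).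
Proof.
move=> [ci _ _ _ co]; have [rr ra rt _] := linB.
have -> : map c (listing rA) = [seq x <- listing rB | x \in map c (listing rA)].
  apply: (sorted_eq rt ra).
  - by rewrite (homo_sorted co) // listing_sorted.
  - by apply: sorted_filter => //; apply: listing_sorted.
  apply: uniq_perm; rewrite ?filter_uniq ?listing_uniq ?map_inj_uniq ?listing_uniq //.
  by move=> x; rewrite mem_filter mem_listing andbT.
exact: filter_subseq.
Qed.

(** The copy of [A] attached to a sequence [s] of numbers uses the entries of
    [s], in order, as numbers. A copy of [A] inside the copy of [B] attached to
    [s] is the one attached to the subsequence of numbers that it uses. *)
Lemma numbering_ramsey (C : finType) (c0 : C) : exists n,
  forall chi : {ffun A -> numbered n} -> C,
  exists2 b, b \in numberings n FB labB rB &
  forall c c', ordered_copy c -> ordered_copy c' ->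
    chi (ffun_comp b c) = chi (ffun_comp b c').
Proof.
have [n Hn] := ramsey_subseq nat c0 #|A| #|B|.
exists n.+1 => chi.
pose at_list (T : finType) (r : rel T) (s : seq nat) (x : T) : 'I_n.+1 :=
  inord (nth 0 s (index x (listing r))).
have [|s [col [sub szs Hs]]] :=
  Hn (iota 0 n.+1) (fun s => chi (numbering FA labA (at_list A rA s))).
  by rewrite size_iota.
have sn i : i < #|B| -> nth 0 s i < n.+1.
  move=> iB; have : nth 0 s i \in iota 0 n.+1.
    by apply: (mem_subseq sub); rewrite mem_nth // szs.
  by rewrite mem_iota add0n.
have idxB x : index x (listing rB) < #|B|.
  by rewrite cardE -(size_sort rB) index_mem mem_listing.
have s_sorted : sorted ltn s.
  exact: (subseq_sorted ltn_trans sub (iota_ltn_sorted 0 n.+1)).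
have h_mono x y : strict_rel rB x y -> at_list B rB s x < at_list B rB s y.
  move=> xy; rewrite /at_list !inordK ?sn //.
  apply: (sorted_ltn_nth ltn_trans) => //; rewrite ?inE ?szs //.
  exact: index_listing.
have h_inj : injective (at_list B rB s).
  have [_ _ _ tot] := linB.
  move=> x y e; apply/eqP; apply: contraT => ne.
  have /orP[xy|yx] := tot x y.
    by have := h_mono x y; rewrite /strict_rel ne xy e ltnn => /(_ isT).
  by have := h_mono y x; rewrite /strict_rel eq_sym ne yx e ltnn => /(_ isT).
exists (numbering FB labB (at_list B rB s)).
  exact: numbering_numberings.
suff colE c : ordered_copy c ->
    chi (ffun_comp (numbering FB labB (at_list B rB s)) c) = col.
  by move=> c c' /colE-> /colE->.
move=> cc; have [ci ca _ cl _] := cc.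
pose t := [seq nth 0 s (index x (listing rB)) | x <- map c (listing rA)].
have sE : s = [seq nth 0 s (index x (listing rB)) | x <- listing rB].
  apply: (@eq_from_nth _ 0); first by rewrite size_map size_sort -cardE.
  move=> i; rewrite szs => iB.
  have x0 : B by case: (enum B) (cardE B) iB => [->|x].
  have iB' : i < size (listing rB) by rewrite size_sort -cardE.
  by rewrite (nth_map x0) // index_uniq // listing_uniq.
rewrite -(Hs t); last 2 first.
- by rewrite [X in subseq _ X]sE; apply: map_subseq; apply: listing_copy.
- by rewrite !size_map size_sort -cardE.
congr chi; apply/ffunP=> x; apply/ffunP=> o; rewrite !ffunE.
have ca_opt : act_opt FB o (c x) = c (act_opt FA o x) by case: o => //= k; rewrite ca.
rewrite ca_opt cl; congr pair; rewrite /at_list; congr inord.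
set y := act_opt _ _ _; rewrite /t -map_comp (nth_map y) /=; last first.
  by rewrite index_mem mem_listing.
by rewrite nth_index // mem_listing.
Qed.

(** The second system lies over the first one, with all pairs of [B] related. Its
    relation serves to select the pairs that stem from copies of [B]; hence each
    of its triangles lies over a copy of [B] in the first system. *)
Theorem ordered_ramsey (C : finType) (c0 : C) :
  exists n (X1 : system (@numbered_act n)) (X2 : system (@act _ _ _ X1)),
  (forall x y z : X2, triangle x y z -> exists b0 b1 p q r,
     [/\ numberings n FB labB rB b0, is_lift FB EB b0 b1,
         proj x = b1 p, proj y = b1 q & proj z = b1 r]) /\
  (forall chi : {ffun A -> X2} -> C, exists b0 b1 b2,
    [/\ numberings n FB labB rB b0, is_lift FB EB b0 b1,
        is_lift FB (fun _ _ => true) b1 b2 &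
        forall c c', ordered_copy c -> ordered_copy c' ->
          chi (ffun_comp b2 c) = chi (ffun_comp b2 c')]).
Proof.
have [n Hn] := numbering_ramsey c0; exists n.
pose copies : pred {ffun A -> B} := fun c => decide_prop (ordered_copy c).
have copiesP c : reflect (ordered_copy c) (c \in copies) by apply: decide_propP.
have [||chi|X1 [_ H1]] := @partite_construction _ _ (@numbered_act n)
   A FA EA B FB EB C c0 (numberings n FB labB rB) copies.
- by move=> b /numberingsP[].
- by move=> c /copiesP[].
- have [b bb mono] := Hn chi; exists b => // c c' /copiesP cc /copiesP cc'; exact: mono.
exists X1.
pose lifts : pred {ffun B -> X1} := fun b1 =>
  [exists b0, numberings n FB labB rB b0 && is_lift FB EB b0 b1].
have [||chi|X2 [tri H2]] := @partite_construction _ _ (@act _ _ _ X1)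
   A FA (fun _ _ => true) B FB (fun _ _ => true) C c0 lifts copies.
- move=> b1 /existsP[b0 /andP[/numberingsP[b0i _ _ _] /liftP[l1 l2 _]]]; split=> //.
  by move=> p q /(congr1 (@proj _ _ _ _)); rewrite !l1 => /b0i.
- by move=> c /copiesP[].
- have [b0 [b1 [bb0 l1 mono]]] := H1 chi; exists b1 => //.
  by apply/existsP; exists b0; rewrite l1 andbT.
exists X2; split=> [x y z xyz|chi].
  have [b1 [p [q [r [/existsP[b0 /andP[bb0 l1]] xp yq zr]]]]] :=
    tri (fun _ _ => isT) x y z xyz.
  by exists b0, b1, p, q, r.
have [b1 [b2 [/existsP[b0 /andP[bb0 l1]] l2 mono]]] := H2 chi.
exists b0, b1, b2; split=> // c c' cc cc'; apply: mono; exact/copiesP.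
Qed.

End OrderedRamsey.

Arguments numberings {K L} n {T}.

(** * Frames: disjoint unions of chimneys and K4s *)

(** The labels 0 and 1 stand for the left and right vertex of the centre of a
    chimney, 2 to 5 for the four vertices of a K4, and 6 for a non-central
    vertex. *)
Definition k4_label (l : 'I_7) : bool := 2 <= l < 6.

(** The label of the vertex that the map [F k] picks from the centre. All of
    [F 1], [F 2] and [F 3] pick the right vertex of a chimney, so that the maps
    are total and satisfy one law, [F k (F j x) = F k x], on both kinds of
    blocks. *)
Definition slot_label (k4 : bool) (k : 'I_4) : nat :=
  if k4 then 2 + k else (k != ord0).

Definition slot_of (l : 'I_7) : 'I_4 := inord (if l < 2 then l : nat else l - 2).

(** The vertices with a common value of [F 0] form a block. *)
Record frame (V : finType) (F : 'I_4 -> V -> V) (lab : V -> 'I_7) : Prop := Frame {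
  frame_act : forall k j x, F k (F j x) = F k x;
  frame_lab : forall k x, lab (F k x) = slot_label (k4_label (lab x)) k :> nat;
  frame_fix : forall x, lab x < 6 -> F (slot_of (lab x)) x = x;
  frame_leaves : forall x, ~~ k4_label (lab x) -> exists y z,
    [/\ y != z, lab y = 6 :> nat, lab z = 6 :> nat,
        F ord0 y = F ord0 x & F ord0 z = F ord0 x] }.

Lemma triangle_mem (V : finType) (e : rel V) : symmetric e -> irreflexive e ->
  forall a b c, e a b -> e a c -> e b c -> [set a; b; c] \in triangles e.
Proof.
move=> es ei a b c ab ac bc.
have ne x y : e x y -> x != y by apply: contraTneq => ->; rewrite ei.
rewrite inE -setUA cardsU1 cards2 !inE negb_or !ne //=.
apply/forall_inP=> x; rewrite !inE => xS; apply/forall_inP=> y; rewrite !inE => yS.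
move: xS yS; case/or3P=> /eqP->; case/or3P=> /eqP->; rewrite ?eqxx //;
  by rewrite ?ab ?ac ?bc ?(es b a) ?(es c a) ?(es c b) ?ab ?ac ?bc ?implybT.
Qed.

Lemma two_triangles_central (V : finType) (e : rel V) : symmetric e -> irreflexive e ->
  forall x a b c, e x a -> e x b -> e x c -> e a b -> e a c -> b != c -> central e x.
Proof.
move=> es ei x a b c xa xb xc ab ac bc.
have ne u v : e u v -> (u == v) = false by move=> uv; apply/eqP=> E; rewrite E ei in uv.
apply/card_gt1P; exists [set x; a; b], [set x; a; c].
have mem u v : e x u -> e x v -> e u v ->
    [set x; u; v] \in [set T in triangles e | x \in T].
  by move=> xu xv uv; rewrite in_set triangle_mem // !inE eqxx.
split; [exact: mem | exact: mem |].
apply: contraNneq bc => /setP/(_ b); rewrite !inE eqxx orbT.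
by rewrite eq_sym ne // eq_sym ne //= => /esym.
Qed.

Section Frames.

Variables (V : finType) (F : 'I_4 -> V -> V) (lab : V -> 'I_7).
Hypothesis fr : frame F lab.

Definition block_edge : rel V := fun x y =>
  [&& x != y, F ord0 x == F ord0 y & (lab x < 6) || (lab y < 6)].

Lemma block_edge_sym : symmetric block_edge.
Proof. by move=> x y; rewrite /block_edge eq_sym [F _ x == _]eq_sym orbC. Qed.

Lemma same_block_act k x y : F ord0 x = F ord0 y -> F k x = F k y.
Proof. by move=> e; rewrite -(frame_act fr k ord0 x) e (frame_act fr). Qed.

Lemma block_act k x : F ord0 (F k x) = F ord0 x.
Proof. exact: frame_act fr _ _ _. Qed.

Lemma same_block_k4 x y : F ord0 x = F ord0 y -> k4_label (lab x) = k4_label (lab y).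
Proof.
move=> e; have := frame_lab fr ord0 x; rewrite e (frame_lab fr ord0 y).
by rewrite /slot_label; case: k4_label; case: k4_label.
Qed.

Lemma central_slot x y : lab x < 6 -> F ord0 x = F ord0 y -> x = F (slot_of (lab x)) y.
Proof. by move=> cx e; rewrite -(same_block_act _ e) (frame_fix fr). Qed.

(** The label of a central vertex tells which map picks it. *)
Lemma central_lab_inj x y : lab x < 6 -> F ord0 x = F ord0 y -> lab x = lab y -> x = y.
Proof.
move=> cx e el; rewrite (central_slot cx e) el; apply: (frame_fix fr).
by rewrite -el.
Qed.

Lemma chimney_lab x : ~~ k4_label (lab x) -> (lab x : nat) \in [:: 0; 1; 6].
Proof. by case: (lab x) => [[|[|[|[|[|[|[|]]]]]]] ?]. Qed.

Lemma lab_act_lt k x : lab (F k x) < 6.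
Proof.
rewrite (frame_lab fr) /slot_label; have := ltn_ord k.
by case: k4_label => //; case: (_ != _).
Qed.

(** Two vertices of a block are joined unless they are equal or both
    non-central, and these are the pairs with equal labels. *)
Lemma block_edge_lab x y : F ord0 x = F ord0 y ->
  (lab x != lab y :> nat) = block_edge x y.
Proof.
move=> e; rewrite /block_edge e eqxx /=; apply/idP/andP=> [ne|[ne]].
  split; first by apply: contraNneq ne => ->.
  by have := ltn_ord (lab x); have := ltn_ord (lab y); lia.
have sym a b : lab a < 6 -> F ord0 a = F ord0 b -> a != b -> lab a != lab b :> nat.
  move=> ca eab; apply: contraNneq => /val_inj eab'.
  by rewrite (central_lab_inj ca eab eab').
by case/orP=> [cx|cy]; [apply: sym | rewrite eq_sym; apply: sym; rewrite // eq_sym].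
Qed.

Lemma block_edge_slot x y : block_edge x y -> exists k, x = F k y \/ y = F k x.
Proof.
case/and3P=> _ /eqP e /orP[cx|cy].
  by exists (slot_of (lab x)); left; apply: central_slot.
by exists (slot_of (lab y)); right; apply: central_slot.
Qed.

Lemma block_edge_act k x : F k x != x -> block_edge x (F k x).
Proof. by move=> ne; rewrite /block_edge eq_sym ne block_act eqxx lab_act_lt orbT. Qed.

(** The other three labels of a K4. *)
Lemma other_slots (l : 'I_7) : k4_label l -> exists k1 k2 k3 : 'I_4,
  uniq [:: (l : nat); 2 + k1; 2 + k2; 2 + k3].
Proof.
pose o (n : nat) : 'I_4 := inord n.
have H a b c : uniq [:: (l : nat); 2 + a; 2 + b; 2 + c] -> a < 4 -> b < 4 -> c < 4 ->
    exists k1 k2 k3 : 'I_4, uniq [:: (l : nat); 2 + k1; 2 + k2; 2 + k3].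
  by move=> u a4 b4 c4; exists (o a), (o b), (o c); rewrite !inordK.
case: l H => [[|[|[|[|[|[|[|]]]]]]] ?] //= H _.
- exact: (H 1 2 3).
- exact: (H 0 2 3).
- exact: (H 0 1 3).
- exact: (H 0 1 2).
Qed.

Lemma central_neighbours x : lab x < 6 -> exists a b c,
  [/\ block_edge x a, block_edge x b, block_edge x c, block_edge a b &
      block_edge a c /\ b != c].
Proof.
move=> cx; have [k4|nk4] := boolP (k4_label (lab x)).
  have [k1 [k2 [k3 /= u]]] := other_slots k4.
  exists (F k1 x), (F k2 x), (F k3 x).
  have L k : lab (F k x) = 2 + k :> nat by rewrite (frame_lab fr) k4.
  rewrite -!block_edge_lab ?block_act // !L.
  have neL (k k' : 'I_4) : k != k' :> nat -> F k x != F k' x.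
    by apply: contraNneq => e; have := L k; rewrite e L => /addnI->.
  move: u; rewrite !inE !negb_or !eqn_add2l => /and4P[/and3P[? ? ?] /andP[? ?] ? _].
  by split=> //; split=> //; apply: neL.
have [y [z [yz ly lz yx zx]]] := frame_leaves fr nk4.
pose k : 'I_4 := inord (lab x == 0 :> nat).
exists (F k x), y, z.
have L : lab (F k x) = (lab x == 0 :> nat) :> nat.
  rewrite (frame_lab fr) (negPf nk4) /slot_label /k -val_eqE /=.
  by case: (lab x == 0 :> nat); rewrite inordK.
rewrite -!block_edge_lab ?block_act // L ly lz.
by move: nk4 cx; rewrite /k4_label; split=> //; lia.
Qed.

Lemma block_edge_common x y : block_edge x y -> exists2 z, block_edge x z & block_edge y z.
Proof.
have main a b : lab a < 6 -> block_edge a b -> exists2 z, block_edge a z & block_edge b z.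
  move=> ca ab; have [u [v [w [au av aw uv [uw vw]]]]] := central_neighbours ca.
  have sm c d : block_edge c d -> F ord0 c = F ord0 d by case/and3P=> _ /eqP.
  move: (sm _ _ au) (sm _ _ av) (sm _ _ aw) (sm _ _ ab) => eu ev ew eb.
  have [e|ub] := eqVneq u b; first by exists v; rewrite // -e.
  exists u => //; rewrite -block_edge_lab; last by rewrite -eb -eu.
  apply: contraTneq ub => elab; rewrite negbK.
  have [cu|lu] := boolP (lab u < 6).
    by apply/eqP; apply: central_lab_inj; rewrite -?eu -?eb //; apply: val_inj.
  (* Otherwise b and u are leaves of one chimney, so v and w, which are adjacent
     to both a and u, are both the centre vertex other than a. *)
  have nk4 : ~~ k4_label (lab u) by rewrite /k4_label (negPf lu) andbF.
  have k4u := same_block_k4 eu; have k4v := same_block_k4 ev; have k4w := same_block_k4 ew.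
  case/eqP: (vw); move: uv uw av aw.
  rewrite -!block_edge_lab -?eu -?ev -?ew // => uv uw av aw.
  have l7u := ltn_ord (lab u); have l7v := ltn_ord (lab v); have l7w := ltn_ord (lab w).
  apply: central_lab_inj; rewrite -?ev //; [|apply: ord_inj];
    by move: k4u k4v k4w nk4; rewrite /k4_label; lia.
move=> xy; have /and3P[_ _ /orP[cx|cy]] := xy; first exact: main.
by rewrite block_edge_sym in xy; have [z ? ?] := main _ _ cy xy; exists z.
Qed.

Variable e : rel V.

(** The last condition says that the triangles are those inside the blocks; all
    graph-theoretic notions for such an edge relation can be read off from the
    labels. *)
Record framed_edge : Prop := FramedEdge {
  framed_sym : symmetric e;
  framed_irr : irreflexive e;
  framed_block : subrel block_edge e;
  framed_free : forall x y z, e x y -> e x z -> e y z -> block_edge x y }.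

Hypothesis fe : framed_edge.

Lemma E0_framed : E0 e =2 block_edge.
Proof.
move=> x y; rewrite /E0; apply/andP/idP=> [[xy /existsP[z /andP[xz yz]]]|xy].
  exact: framed_free xy xz yz.
split; first exact: framed_block.
have [z xz yz] := block_edge_common xy; apply/existsP; exists z.
by rewrite !(framed_block fe).
Qed.

Lemma framed_triangle x y z : e x y -> e x z -> e y z ->
  [/\ block_edge x y, block_edge x z & block_edge y z].
Proof.
move=> xy xz yz; have es := framed_sym fe; split.
- exact: (framed_free fe xy xz yz).
- by apply: (framed_free fe xz xy); rewrite es.
- by apply: (framed_free fe yz (z := x)); rewrite es.
Qed.

Lemma same_block x y : block_edge x y -> F ord0 x = F ord0 y.
Proof. by case/and3P=> _ /eqP. Qed.

(** There are no labels for a bowtie with middle vertex 0 inside a block: a K4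
    has too few vertices, and in a chimney each triangle contains both vertices of
    the centre, while vertices of different triangles can only agree in the
    label 6. *)
Lemma bowtie_labels (k4 : bool) (l0 l1 l2 l3 l4 : nat) :
  all (fun l => (l < 7) && ((1 < l < 6) == k4)) [:: l0; l1; l2; l3; l4] ->
  uniq [:: l0; l1; l2] -> uniq [:: l0; l3; l4] ->
  all (fun p => (p.1 == p.2) ==> (p.1 == 6))
    [:: (l1, l3); (l1, l4); (l2, l3); (l2, l4)] ->
  False.
Proof.
pose P l0 l1 l2 l3 l4 := [&& uniq [:: l0; l1; l2], uniq [:: l0; l3; l4] &
  all (fun p : nat * nat => (p.1 == p.2) ==> (p.1 == 6))
    [:: (l1, l3); (l1, l4); (l2, l3); (l2, l4)]].
pose D := [seq l <- iota 0 7 | (1 < l < 6) == k4].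
move=> /allP range u v w.
have mem l : l \in [:: l0; l1; l2; l3; l4] -> l \in D.
  by move/range; rewrite mem_filter mem_iota add0n andbC.
have : P l0 l1 l2 l3 l4 by rewrite /P u v w.
(* Five labels of one kind: a finite computation. *)
suff /allP/(_ l0 (mem _ _))/allP/(_ l1 (mem _ _))/allP/(_ l2 (mem _ _))
     /allP/(_ l3 (mem _ _))/allP/(_ l4 (mem _ _)) H :
  all (fun l0 => all (fun l1 => all (fun l2 => all (fun l3 =>
    all (fun l4 => ~~ P l0 l1 l2 l3 l4) D) D) D) D) D.
  by apply/negP/H; rewrite !inE eqxx ?orbT.
by rewrite /P /D; case: k4 {D mem range}; vm_compute.
Qed.

Lemma framed_bowtie_free : bowtie_free e.
Proof.
case=> f [f_inj f_adj].
pose v i : V := f (inord i).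
have adj i j : i < 5 -> j < 5 -> bowtie (inord i) (inord j) -> e (v i) (v j).
  by move=> *; apply: f_adj.
have B i j : i < 5 -> j < 5 -> (i != j) &&
    ((i \in [:: 0; 1; 2]) && (j \in [:: 0; 1; 2]) ||
     (i \in [:: 0; 3; 4]) && (j \in [:: 0; 3; 4])) ->
    e (v i) (v j).
  by move=> i5 j5 h; apply: adj; rewrite // /bowtie -val_eqE /= !inordK.
have [b01 b02 b12] :=
  framed_triangle (B 0 1 isT isT isT) (B 0 2 isT isT isT) (B 1 2 isT isT isT).
have [b03 b04 b34] :=
  framed_triangle (B 0 3 isT isT isT) (B 0 4 isT isT isT) (B 3 4 isT isT isT).
have s01 := same_block b01; have s02 := same_block b02.
have s03 := same_block b03; have s04 := same_block b04.
have k1 := same_block_k4 s01; have k2 := same_block_k4 s02.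
have k3 := same_block_k4 s03; have k4 := same_block_k4 s04.
have far i j : i < 5 -> j < 5 -> i != j -> F ord0 (v 0) = F ord0 (v i) ->
    F ord0 (v 0) = F ord0 (v j) -> lab (v i) = lab (v j) :> nat -> lab (v i) = 6 :> nat.
  move=> i5 j5 ne si sj el.
  have := ltn_ord (lab (v i)); rewrite ltnS leq_eqVlt => /orP[/eqP//|ci].
  case/eqP: ne; have := central_lab_inj ci (etrans (esym si) sj) (ord_inj el).
  by move/f_inj/(congr1 val); rewrite /= !inordK.
have f13 := far 1 3 isT isT isT s01 s03; have f14 := far 1 4 isT isT isT s01 s04.
have f23 := far 2 3 isT isT isT s02 s03; have f24 := far 2 4 isT isT isT s02 s04.
have rg i : F ord0 (v 0) = F ord0 (v i) ->
    (lab (v i) < 7) && ((1 < lab (v i) < 6) == k4_label (lab (v 0))).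
  by move=> s0i; rewrite ltn_ord (same_block_k4 s0i) eqxx.
apply: (@bowtie_labels (k4_label (lab (v 0)))
  (lab (v 0)) (lab (v 1)) (lab (v 2)) (lab (v 3)) (lab (v 4))).
- by rewrite /= !rg.
- by rewrite /= !inE !negb_or !block_edge_lab -?s01 -?s02 // b01 b02 b12.
- by rewrite /= !inE !negb_or !block_edge_lab -?s03 -?s04 // b03 b04 b34.
rewrite /= andbT; apply/and4P; split; apply/implyP=> /eqP E; apply/eqP.
- exact: f13.
- exact: f14.
- exact: f23.
- exact: f24.
Qed.

Lemma same_component_framed x y : same_component e x y = (F ord0 x == F ord0 y).
Proof.
rewrite /same_component (eq_connect E0_framed); apply/connectP/eqP=> [[p pth ->]|exy].
  elim: p x pth => [|z p IH] x //= /andP[/same_block-> /IH]; exact.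
suff : connect block_edge x y by case/connectP=> p; exists p.
have to0 z : connect block_edge z (F ord0 z).
  have [->|ne] := eqVneq (F ord0 z) z; first exact: connect0.
  exact/connect1/block_edge_act.
apply: connect_trans (to0 x) _; rewrite exy sym_connect_sym //; exact: block_edge_sym.
Qed.

Lemma central_framed x : central e x = (lab x < 6).
Proof.
have es := framed_sym fe; have ei := framed_irr fe.
apply/idP/idP=> [/(central_triangles es ei)[[a b] [[c d] /=]]|cx].
  move=> [/and3P[xa xb ab] /and3P[xc xd cd]]; apply: contraR => lx.
  have nk4 : ~~ k4_label (lab x) by rewrite /k4_label (negPf lx) andbF.
  have [k1 l1] : exists k1, lab (F k1 x) = 1 :> nat.
    exists (inord 1); by rewrite (frame_lab fr) (negPf nk4) /slot_label -val_eqE /= inordK.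
  have l0 : lab (F ord0 x) = 0 :> nat by rewrite (frame_lab fr) (negPf nk4).
  have pair a' b' : e x a' -> e x b' -> e a' b' ->
      [set a'; b'] = [set F ord0 x; F k1 x].
    move=> xa' xb' ab'; have [Ba Bb Bab] := framed_triangle xa' xb' ab'.
    have [sa sb] := (same_block Ba, same_block Bb).
    have ka := same_block_k4 sa; have kb := same_block_k4 sb.
    have l7x := ltn_ord (lab x); have l7a := ltn_ord (lab a'); have l7b := ltn_ord (lab b').
    move: Ba Bb Bab; rewrite -!block_edge_lab // -?sa -?sb // => la lb lab'.
    have eqF k y : lab (F k x) = lab y :> nat -> F ord0 x = F ord0 y -> y = F k x.
      move=> el sy; apply/esym/central_lab_inj; rewrite ?lab_act_lt ?block_act //.
      exact: ord_inj.
    have [[a0 b1]|[a1 b0]] : (lab a' = 0 :> nat /\ lab b' = 1 :> nat) \/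
        (lab a' = 1 :> nat /\ lab b' = 0 :> nat).
      have Lx : lab x = 6 :> nat.
        by move: (chimney_lab nk4) lx; rewrite !inE => /or3P[]/eqP->.
      rewrite Lx in la lb; rewrite ka in nk4.
      have := chimney_lab nk4; rewrite -ka kb in nk4.
      have := chimney_lab nk4; rewrite !inE => /or3P[]/eqP eb /or3P[]/eqP ea;
        rewrite ?ea ?eb // in la lb lab' *; by [left | right].
    - by rewrite -(eqF ord0 a') ?l0 // -(eqF k1 b') ?l1.
    - by rewrite -(eqF ord0 b') ?l0 // -(eqF k1 a') ?l1 // setUC.
  by rewrite (pair a b) ?(pair c d).
have [a [b [c [xa xb xc ab [ac bc]]]]] := central_neighbours cx.
by apply: (@two_triangles_central _ _ es ei x a b c) => //; apply: (framed_block fe).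
Qed.

Lemma centre_framed x : centre e x = [set F k x | k : 'I_4].
Proof.
apply/setP=> y; rewrite inE central_framed same_component_framed.
apply/andP/imsetP=> [[cy /eqP sxy]|[k _ ->]].
  by exists (slot_of (lab y)) => //; apply: central_slot.
by rewrite lab_act_lt block_act.
Qed.

Lemma k4_block_edge x j k : k4_label (lab x) -> j != k -> block_edge (F j x) (F k x).
Proof.
move=> k4 jk; rewrite -block_edge_lab ?block_act // !(frame_lab fr) k4.
by rewrite /slot_label eqn_add2l.
Qed.

Lemma slot_of_k4 x k : k4_label (lab x) -> slot_of (lab (F k x)) = k.
Proof.
move=> k4; apply: val_inj; rewrite /slot_of (frame_lab fr) k4 /slot_label.
by rewrite /= inordK; have := ltn_ord k; lia.
Qed.

(** The labels of a chimney are 0, 1 and 6, too few for four vertices with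
    pairwise different labels. *)
Lemma K4_block (f : 'I_4 -> V) : subgraph_copy K4 e f ->
  (forall i j, F ord0 (f i) = F ord0 (f j)) /\ forall i, k4_label (lab (f i)).
Proof.
move=> [f_inj f_adj].
have adj i j : i != j -> block_edge (f i) (f j).
  move=> ij; have [k ki kj] : exists2 k : 'I_4, i != k & j != k.
    have /subsetPn[k _] : ~~ ([set: 'I_4] \subset [set i; j]).
      apply: contraT; rewrite negbK => /subset_leq_card.
      by rewrite cardsT card_ord cards2 ij.
    by rewrite !inE negb_or eq_sym [k == j]eq_sym => /andP[]; exists k.
  by apply: (@framed_free fe _ _ (f k)); apply: f_adj.
have sb i j : F ord0 (f i) = F ord0 (f j).
  by have [->//|/adj/same_block] := eqVneq i j.
split=> // i; apply: contraT => nk.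
have lab_inj : injective (fun j => lab (f j) : nat).
  move=> j k /eqP; apply: contraTeq => jk.
  by rewrite block_edge_lab ?(sb j k) // adj.
have : uniq [seq (lab (f j) : nat) | j <- enum 'I_4] by rewrite map_inj_uniq // enum_uniq.
move/(@uniq_leq_size _ _ [:: 0; 1; 6]); rewrite size_map size_enum_ord.
apply=> l /mapP[j _ ->].
by apply: chimney_lab; rewrite (same_block_k4 (sb j i)).
Qed.

Lemma k4_subgraph x : k4_label (lab x) -> subgraph_copy K4 e (F ^~ x).
Proof.
move=> k4; split; last by move=> j k jk; apply/(framed_block fe)/k4_block_edge.
by move=> j k e'; rewrite -(slot_of_k4 j k4) e' slot_of_k4.
Qed.

Lemma in_K4_framed x : in_K4 e x <-> k4_label (lab x).
Proof.
split=> [[f /K4_block[_ h] [i <-]]|k4]; first exact: h.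
exists (F ^~ x); first exact: k4_subgraph.
by exists (slot_of (lab x)); apply: (frame_fix fr); case/andP: k4.
Qed.

(** No further edges run inside a block: an edge between two non-central
    vertices of a chimney would form a triangle with its centre. *)
Lemma framed_same_block x y : F ord0 x = F ord0 y -> e x y = (lab x != lab y :> nat).
Proof.
move=> exy; rewrite block_edge_lab //; apply/idP/idP=> [xy|]; last exact: framed_block.
rewrite -block_edge_lab //; apply/eqP=> el.
have [cx|lx] := boolP (lab x < 6).
  by move: xy; rewrite (central_lab_inj cx exy (ord_inj el)) (framed_irr fe).
have sx : F ord0 x != x by apply: contraNneq lx => <-; exact: lab_act_lt.
have sy : F ord0 y != y.
  by apply: contraNneq lx => e'; rewrite el -e'; exact: lab_act_lt.
have /(framed_block fe) ux := block_edge_act sx.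
have /(framed_block fe) := block_edge_act sy; rewrite -exy => uy.
by have := framed_free fe xy ux uy; rewrite -block_edge_lab // el eqxx.
Qed.

Lemma chimney_two_leaves u v y z : y != z ->
  F ord0 v = F ord0 u -> F ord0 y = F ord0 u -> F ord0 z = F ord0 u ->
  lab u < 2 -> lab v < 2 -> lab u != lab v -> lab y = 6 :> nat -> lab z = 6 :> nat ->
  induced_copy (@chimney 2) e (fun i : 'I_4 => nth u [:: u; v; y; z] i).
Proof.
move=> yz ev ey ez lu lv luv ly lz.
have uv : lab u != lab v :> nat by [].
have neq6 n : n < 2 -> (n == 6) = false by case: n => [|[|]].
pose s := [:: u; v; y; z]; pose ls := [:: lab u : nat; lab v : nat; 6; 6].
have sE (i : 'I_4) : F ord0 (nth u s i) = F ord0 u /\ lab (nth u s i) = nth 0 ls i :> nat.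
  by case: i => [[|[|[|[|]]]] ?].
split.
  have U : uniq s.
    have ne a b : lab a != lab b :> nat -> a != b by apply: contraNneq => ->.
    by rewrite /= !inE !negb_or yz !ne ?ly ?lz ?neq6.
  by move=> i j /eqP; rewrite nth_uniq // => /eqP/val_inj.
move=> i j; have [Fi li] := sE i; have [Fj lj] := sE j.
rewrite framed_same_block ?li ?lj ?Fi ?Fj // /chimney -val_eqE.
have [vu nu nv] : [/\ (lab v != lab u :> nat), (6 == lab u :> nat) = false &
    (6 == lab v :> nat) = false].
  by rewrite eq_sym uv ![6 == _]eq_sym !neq6.
by case: j {Fj lj} => [[|[|[|[|]]]] ?] //; case: i {Fi li} => [[|[|[|[|]]]] ?] //=;
  rewrite ?eqxx ?uv ?vu ?nu ?nv ?neq6.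
Qed.

Lemma chimney_framed u v : chimney_centre e u v <->
  [/\ F ord0 u = F ord0 v, lab u < 2, lab v < 2 & lab u != lab v].
Proof.
split=> [[n [f [n2 [f_inj f_ind] f0 f1]]]|[euv lu lv luv]]; last first.
  have nk4 : ~~ k4_label (lab u) by rewrite /k4_label leqNgt lu.
  have [y [z [yz ly lz ey ez]]] := frame_leaves fr nk4.
  exists 2, (fun i : 'I_4 => nth u [:: u; v; y; z] i); rewrite /= inordK //; split=> //.
  exact: chimney_two_leaves.
pose g i := f (inord i).
have lt4 i : i < 4 -> i < n.+2 by move/leq_trans; apply; rewrite !ltnS.
have gE i j : i < 4 -> j < 4 -> e (g i) (g j) = (i != j) && ((i < 2) || (j < 2)).
  by move=> i4 j4; rewrite -f_ind /chimney -val_eqE /= !inordK ?lt4.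
have g0 : g 0 = u by rewrite -f0; congr f; apply: val_inj; rewrite /= inordK.
move: (gE 0 1 isT isT) (gE 0 2 isT isT) (gE 1 2 isT isT).
move: (gE 0 3 isT isT) (gE 1 3 isT isT) (gE 2 3 isT isT).
rewrite g0 [g 1]f1 /= => uz vz yz uv uy vy.
have [Buv Buy Bvy] := framed_triangle uv uy vy.
have [_ Buz Bvz] := framed_triangle uv uz vz.
have euv := same_block Buv; have euy := same_block Buy; have euz := same_block Buz.
have ly : lab (g 2) = 6 :> nat.
  have := yz; rewrite framed_same_block -?euy // => /negbFE/eqP el.
  have := ltn_ord (lab (g 2)); rewrite ltnS leq_eqVlt => /orP[/eqP//|cy].
  have := central_lab_inj cy (etrans (esym euy) euz) (ord_inj el).
  by move/f_inj/(congr1 val); rewrite /= !inordK ?lt4.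
have ky : ~~ k4_label (lab (g 2)) by rewrite /k4_label ly.
have lab01 x : F ord0 x = F ord0 (g 2) -> block_edge x (g 2) -> lab x < 2.
  move=> ex; rewrite -block_edge_lab // ly; have := @chimney_lab x.
  rewrite (same_block_k4 ex) => /(_ ky); by rewrite !inE => /or3P[]/eqP->.
split=> //; try (by apply: lab01; rewrite -?euv).
by have := Buv; rewrite -block_edge_lab.
Qed.

Lemma framed_good : good_graph e.
Proof.
move=> x; have [k4|nk4] := boolP (k4_label (lab x)); first by right; apply/in_K4_framed.
left; have [y [z [yz ly lz ey ez]]] := frame_leaves fr nk4.
have [k1 l1] : exists k1, lab (F k1 x) = 1 :> nat.
  exists (inord 1); by rewrite (frame_lab fr) (negPf nk4) /slot_label -val_eqE /= inordK.
have l0 : lab (F ord0 x) = 0 :> nat by rewrite (frame_lab fr) (negPf nk4).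
have l01 : lab (F ord0 x) != lab (F k1 x) by rewrite -val_eqE /= l0 l1.
have main (y' z' : V) : y' != z' -> lab y' = 6 :> nat -> lab z' = 6 :> nat ->
    F ord0 y' = F ord0 x -> F ord0 z' = F ord0 x -> x \in [:: F ord0 x; F k1 x; y'; z'] -> in_chimney e x.
  move=> yz' ly' lz' ey' ez' xs.
  exists 2, (fun i : 'I_4 => nth (F ord0 x) [:: F ord0 x; F k1 x; y'; z'] i).
  split=> //; first by apply: chimney_two_leaves; rewrite ?block_act // ?l0 ?l1.
  have xi : index x [:: F ord0 x; F k1 x; y'; z'] < 4 by rewrite index_mem.
  by exists (Ordinal xi); rewrite nth_index.
have : (lab x : nat) \in [:: 0; 1; 6] := chimney_lab nk4; rewrite !inE => /or3P[]/eqP lx.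
- have e0 : x = F ord0 x.
    by apply: central_lab_inj; rewrite ?lx ?block_act //; apply: ord_inj; rewrite lx.
  by apply: (main y z) => //; rewrite !inE -e0 eqxx.
- have e1 : x = F k1 x.
    by apply: central_lab_inj; rewrite ?lx ?block_act //; apply: ord_inj; rewrite lx.
  by apply: (main y z) => //; rewrite !inE -e1 eqxx orbT.
have [xy|xy] := eqVneq x y.
  by apply: (main x z); rewrite ?inE ?eqxx ?orbT // xy.
by apply: (main x y); rewrite ?inE ?eqxx ?orbT.
Qed.

End Frames.

(** * Blocks of a good bowtie-free graph *)

Section GoodGraphs.

Variables (V : finType) (e : rel V).
Hypotheses (es : symmetric e) (ei : irreflexive e) (bf : bowtie_free e).

Let meet := bowtie_free_meet es ei bf.

Definition k4_block (x : V) : Prop :=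
  [/\ #|centre e x| = 4, forall y, same_component e x y -> central e y &
      forall y z, same_component e x y -> same_component e x z -> y != z -> e y z].

Definition chimney_block (x : V) : Prop := exists a b,
  [/\ a != b, centre e x = [set a; b], e a b,
      exists y z, [/\ y != z, same_component e x y, same_component e x z,
                      ~~ central e y & ~~ central e z] &
      (forall y, same_component e x y -> ~~ central e y -> e y a /\ e y b) /\
      (forall y z, same_component e x y -> same_component e x z ->
         ~~ central e y -> ~~ central e z -> ~~ e y z)].

Lemma edge_neq x y : e x y -> x != y.
Proof. by apply: contraTneq => ->; rewrite ei. Qed.

(** Every edge of E_0 lies in a triangle, so it suffices that no triangle leaves
    the set. *)
Lemma component_closed (P : pred V) :
  (forall u v w, P u -> e u v -> e u w -> e v w -> P v) ->
  forall x y, P x -> same_component e x y -> P y.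
Proof.
move=> clo x y Px /connectP[p pth ->].
elim: p x Px pth => [|z p IH] x Px //= /andP[/andP[xz /existsP[w /andP[xw zw]]] pth].
by apply: IH pth; apply: clo xz xw zw.
Qed.

Lemma E0_triangle u v w : e u v -> e u w -> e v w -> same_component e u v.
Proof.
by move=> uv uw vw; apply/connect1/andP; split=> //; apply/existsP; exists w; rewrite uw.
Qed.

(** A triangle that shares the vertex [u] with a K4 has to meet each of the three
    pairs of further vertices of the K4, hence lies inside. *)
Lemma k4_block_exists (f : 'I_4 -> V) i : subgraph_copy K4 e f -> k4_block (f i).
Proof.
move=> [f_inj f_adj].
pose Q u := [exists j, f j == u].
have Qadj u v : Q u -> Q v -> u != v -> e u v.
  move=> /existsP[j /eqP<-] /existsP[k /eqP<-] ne; apply: f_adj.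
  by apply: contraNneq ne => ->.
have others u : Q u -> exists a b c,
    [/\ Q a, Q b, Q c, [/\ e u a, e u b & e u c] & [/\ e a b, e a c & e b c]].
  move=> /existsP[j /eqP<-].
  have [k1 [k2 [k3]]] : exists k1 k2 k3 : 'I_4, uniq [:: j; k1; k2; k3].
    pose s := rem j (enum 'I_4).
    have js : j \notin s by rewrite mem_rem_uniqF ?enum_uniq.
    have us : uniq s by rewrite rem_uniq ?enum_uniq.
    have : size s = 3 by rewrite size_rem ?mem_enum // size_enum_ord.
    case: s js us => [|k1 [|k2 [|k3 []]]] // js us _.
    by exists k1, k2, k3; rewrite cons_uniq js.
  rewrite /= !inE !negb_or => /and4P[/and3P[j1 j2 j3] /andP[k12 k13] k23 _].
  have Qf k : Q (f k) by apply/existsP; exists k.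
  by exists (f k1), (f k2), (f k3); split=> //; split; apply: f_adj.
have clo u v w : Q u -> e u v -> e u w -> e v w -> Q v.
  move=> /others[a [b [c [Qa Qb Qc [ua ub uc] [ab ac bc]]]]] uv uw vw.
  apply: contraT => nQv.
  have nv d : Q d -> (v == d) = false by move=> Qd; apply: contraNF nQv => /eqP->.
  have := meet uv uw vw ua ub ab; have := meet uv uw vw ua uc ac.
  have := meet uv uw vw ub uc bc.
  rewrite !nv //=; move: (edge_neq ab) (edge_neq ac) (edge_neq bc).
  have [->|_] := eqVneq w a; first by move=> /negPf-> /negPf->.
  by have [->|_] := eqVneq w b => //= _ _ /negPf->.
have Qi : Q (f i) by apply/existsP; exists i.
have compQ x : same_component e (f i) x = Q x.
  apply/idP/idP=> [|Qx]; first exact: (component_closed clo Qi).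
  have [<-|ne] := eqVneq (f i) x; first exact: connect0.
  have ix := Qadj _ _ Qi Qx ne.
  have [a [b [c [Qa Qb Qc [ia ib ic] [ab ac bc]]]]] := others _ Qi.
  have [E|xa] := eqVneq x a.
    by rewrite E; apply: (E0_triangle ia ib).
  by apply: (E0_triangle ix ia); apply: Qadj.
have cQ x : Q x -> central e x.
  move=> /others[a [b [c [_ _ _ [ua ub uc] [ab ac bc]]]]].
  by apply: (@two_triangles_central _ _ es ei x a b c) => //; apply: edge_neq.
split.
- have -> : centre e (f i) = f @: setT.
    apply/setP=> x; rewrite inE compQ.
    apply/andP/imsetP=> [[_ /existsP[j /eqP<-]]|[j _ ->]].
      by exists j.
    by split; [apply: cQ|]; apply/existsP; exists j.
  by rewrite card_imset // cardsT card_ord.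
- by move=> y; rewrite compQ => /cQ.
- by move=> y z; rewrite !compQ; apply: Qadj.
Qed.

(** A triangle at [a] meets both pairs [b], [y] and [b], [z]; if it avoids [b], it
    contains [y] and [z], which are not adjacent. *)
Lemma triangle_at_centre a b y z v w : e a b -> e a y -> e b y -> e a z -> e b z ->
  y != z -> ~~ e y z -> e a v -> e a w -> e v w -> v = b \/ w = b.
Proof.
move=> ab ay by_ az bz yz nyz av aw vw.
have [->|vb] := eqVneq v b; first by left.
have [->|wb] := eqVneq w b; first by right.
have := meet av aw vw ab ay by_; have := meet av aw vw ab az bz.
rewrite (negPf vb) (negPf wb) /= => /orP[]/eqP E1 /orP[]/eqP E2; move: vw; rewrite ?E1 ?E2.
- by rewrite -E1 -E2 eqxx in yz.
- by rewrite es (negPf nyz).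
- by rewrite (negPf nyz).
- by rewrite -E1 -E2 eqxx in yz.
Qed.

(** Each triangle at a common neighbour of the centre [a], [b] consists of this
    vertex and the centre. So the component consists of [a], [b] and their common
    neighbours, of which none is central. *)
Lemma chimney_block_exists n (f : 'I_n.+2 -> V) i : 2 <= n ->
  induced_copy (@chimney n) e f -> chimney_block (f i).
Proof.
move=> n2 [f_inj f_ind].
have lt4 j : j < 4 -> j < n.+2 by move/leq_trans; apply; rewrite !ltnS.
pose g j := f (inord j).
have gE j k : j < 4 -> k < 4 -> e (g j) (g k) = (j != k) && ((j < 2) || (k < 2)).
  by move=> j4 k4; rewrite -f_ind /chimney -val_eqE /= !inordK ?lt4.
pose a := g 0; pose b := g 1; pose y := g 2; pose z := g 3.
have ab : e a b by rewrite gE. have ba : e b a by rewrite gE.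
have ay : e a y by rewrite gE. have az : e a z by rewrite gE.
have by_ : e b y by rewrite gE. have bz : e b z by rewrite gE.
have nyz : ~~ e y z by rewrite gE.
have yz : y != z.
  by apply/eqP=> /f_inj/(congr1 val); rewrite /= !inordK ?lt4.
have tri_a v w := triangle_at_centre (v := v) (w := w) ab ay by_ az bz yz nyz.
have tri_b v w := triangle_at_centre (v := v) (w := w) ba by_ ay bz az yz nyz.
pose N u := e a u && e b u.
pose Q u := [|| u == a, u == b | N u].
have tri_N u v w : N u -> e u v -> e u w -> e v w -> [set v; w] = [set a; b].
  move=> /andP[au bu] uv uw vw.
  have ua := au; have ub := bu; rewrite es in ua; rewrite es in ub.
  case/or4P: (meet uv uw vw ua ub ab) => /eqP E; rewrite {}E in uv uw vw *.
  - by have [E|->] := tri_a u w au vw uw; first by rewrite E ei in bu.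
  - by have [E|->] := tri_b u w bu vw uw; [rewrite E ei in au | rewrite setUC].
  - rewrite es in vw; have [E|->] := tri_a u v au vw uv; first by rewrite E ei in bu.
    by rewrite setUC.
  - by rewrite es in vw; have [E|->] := tri_b u v bu vw uv; first by rewrite E ei in au.
have clo u v w : Q u -> e u v -> e u w -> e v w -> Q v.
  case/or3P=> [/eqP->|/eqP->|Nu] uv uw vw; rewrite /Q /N.
  - have [->|E] := tri_a v w uv uw vw; first by rewrite eqxx orbT.
    by subst w; rewrite uv es vw !orbT.
  - have [->|E] := tri_b v w uv uw vw; first by rewrite eqxx.
    by subst w; rewrite uv es vw !orbT.
  - have /setP/(_ v) := tri_N u v w Nu uv uw vw.
    by rewrite !inE eqxx /= => /esym/orP[]->; rewrite ?orbT.
have ca : central e a by apply: (@two_triangles_central _ _ es ei a b y z).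
have cb : central e b by apply: (@two_triangles_central _ _ es ei b a y z).
have ncN u : N u -> ~~ central e u.
  move=> Nu; apply/negP=> /(central_triangles es ei)[[v w] [[v' w'] /=]].
  move=> [/and3P[h1 h2 h3] /and3P[h4 h5 h6]].
  by rewrite (tri_N u v w) ?(tri_N u v' w') // eqxx.
have Qi : Q (f i).
  have fi : f i = g i by rewrite /g inord_val.
  rewrite fi; move: (nat_of_ord i) (ltn_ord i) => [|[|j]] hj; rewrite /Q ?eqxx ?orbT //.
  by rewrite /N /a /b /g -!f_ind /chimney -!val_eqE /= !inordK ?hj ?lt4 // !orbT.
have toa u : Q u -> same_component e u a.
  case/or3P=> [/eqP->|/eqP->|/andP[au bu]]; first exact: connect0.
    by apply: (E0_triangle ba by_ ay).
  by rewrite es in au; rewrite es in bu; apply: (E0_triangle au bu ab).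
have sc := sym_connect_sym (E0_sym es).
have compQ u : same_component e (f i) u = Q u.
  apply/idP/idP=> [|Qu]; first exact: (component_closed clo Qi).
  by apply: connect_trans (toa _ Qi) _; rewrite sc; apply: toa.
have nN u : Q u -> ~~ central e u -> N u.
  by case/or3P=> [/eqP->|/eqP->|//]; rewrite ?ca ?cb.
exists a, b; split; [exact: edge_neq | | by [] | | split].
- apply/setP=> u; rewrite !inE compQ; apply/andP/orP=> [[cu /or3P[->|->|/ncN]]|[]/eqP->].
  + by left.
  + by right.
  + by rewrite cu.
  + by rewrite ca /Q eqxx.
  + by rewrite cb /Q eqxx orbT.
- have Ny : N y by rewrite /N ay by_. have Nz : N z by rewrite /N az bz.
  by exists y, z; rewrite !compQ /Q Ny Nz !orbT !ncN.
- by move=> u; rewrite compQ => Qu /(nN _ Qu)/andP[au bu]; rewrite !(es u).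
- move=> u v; rewrite !compQ => Qu Qv /(nN _ Qu) Nu /(nN _ Qv) /andP[av bv].
  have /andP[au bu] := Nu; apply/negP=> uv; have au' := au; rewrite es in au'.
  have /setP/(_ v) := tri_N u v a Nu uv au' (etrans (es v a) av).
  rewrite !inE eqxx /= => /esym/orP[]/eqP E; subst v; first by rewrite ei in av.
  by rewrite ei in bv.
Qed.

Lemma good_blocks x : good_graph e -> k4_block x \/ chimney_block x.
Proof.
case/(_ x) => [[n [f [n2 hf [i <-]]]]|[f hf [i <-]]].
  by right; apply: chimney_block_exists n2 hf.
by left; apply: k4_block_exists.
Qed.

End GoodGraphs.

(** * Decorations of ordered good graphs *)

(** A frame for the graph in which the labels inside a block follow the
    order. *)
Record decoration (G : ordered_good_graph) (F : 'I_4 -> G -> G) (lab : G -> 'I_7) :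
    Prop := Decoration {
  dec_frame : frame F lab;
  dec_edge : framed_edge F lab (@edge G);
  dec_order : forall x y, F ord0 x = F ord0 y -> lab x < lab y -> vlt x y }.

Section DecorationExists.

Variable G : ordered_good_graph.

Let e : rel G := @edge G.
Let es : symmetric e := @edge_sym G.
Let ei : irreflexive e := @edge_irr G.
Let adm : admissible e (@vle G) := vle_admissible G.
Let lin : linear_order (@vle G) := adm_linear adm.

Definition centre_list (x : G) : seq G := sort (@vle G) (enum (centre e x)).

(** The minimum makes all [k] beyond the length of the centre pick its last
    vertex. *)
Definition centre_slot (k : 'I_4) (x : G) : G :=
  nth x (centre_list x) (minn k (size (centre_list x)).-1).

Definition centre_label (x : G) : 'I_7 :=
  inord (if central e x then
           (if size (centre_list x) == 4 then 2 else 0) + index x (centre_list x)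
         else 6).

Lemma mem_centre_list x y : (y \in centre_list x) = central e y && same_component e x y.
Proof. by rewrite mem_sort mem_enum inE. Qed.

Lemma size_centre_list x : size (centre_list x) = #|centre e x|.
Proof. by rewrite size_sort cardE. Qed.

Lemma centre_list_uniq x : uniq (centre_list x).
Proof. by rewrite sort_uniq enum_uniq. Qed.

Lemma same_component_refl x : same_component e x x.
Proof. exact: connect0. Qed.

Lemma same_component_sym x y : same_component e x y = same_component e y x.
Proof. exact: (sym_connect_sym (E0_sym es)). Qed.

Lemma centre_eq x y : same_component e x y -> centre e x = centre e y.
Proof.
move=> xy; apply/setP=> z; rewrite !inE /same_component.
by rewrite (same_connect (sym_connect_sym (E0_sym es)) xy).
Qed.

Lemma centre_list_eq x y : same_component e x y -> centre_list x = centre_list y.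
Proof. by rewrite /centre_list => /centre_eq->. Qed.

Lemma blocks x : k4_block e x \/ chimney_block e x.
Proof. exact: good_blocks es ei (@edge_bowtie_free G) x (@edge_good G). Qed.

Variant block_spec (x : G) : nat -> bool -> Prop :=
  | BlockK4 of k4_block e x : block_spec x 4 true
  | BlockChimney of chimney_block e x : block_spec x 2 false.

Lemma blockP x : block_spec x (size (centre_list x)) (size (centre_list x) == 4).
Proof.
rewrite size_centre_list; case: (blocks x) => [k4|ch].
  by have [-> _ _] := k4; constructor.
by have [a [b [ab -> _ _ _]]] := ch; rewrite cards2 ab; constructor.
Qed.

Lemma size_centre_list_gt0 x : 0 < size (centre_list x).
Proof. by case: blockP. Qed.

Lemma slot_lt (k : 'I_4) x : minn k (size (centre_list x)).-1 < size (centre_list x).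
Proof. by have := size_centre_list_gt0 x; lia. Qed.

Lemma mem_centre_slot k x : centre_slot k x \in centre_list x.
Proof. by apply: mem_nth; apply: slot_lt. Qed.

Lemma same_component_slot k x : same_component e x (centre_slot k x).
Proof. by have := mem_centre_slot k x; rewrite mem_centre_list => /andP[]. Qed.

Lemma centre_slot_eq k x y : same_component e x y -> centre_slot k x = centre_slot k y.
Proof.
move=> xy; rewrite /centre_slot (centre_list_eq xy).
by apply: set_nth_default; apply: slot_lt.
Qed.

Lemma centre_slot0 x y : centre_slot ord0 x = centre_slot ord0 y -> same_component e x y.
Proof.
move=> exy; apply: connect_trans (same_component_slot ord0 x) _.
by rewrite exy -/(same_component _ _ _) same_component_sym; apply: same_component_slot.
Qed.

Lemma centre_labelE x : centre_label x =
  (if central e x then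
     (if size (centre_list x) == 4 then 2 else 0) + index x (centre_list x)
   else 6) :> nat.
Proof.
rewrite /centre_label inordK //; case: ifP => // cx.
have : index x (centre_list x) < size (centre_list x).
  by rewrite index_mem mem_centre_list cx; apply: connect0.
by case: blockP => _; lia.
Qed.

Lemma central_centre_label x : (centre_label x < 6) = central e x.
Proof.
rewrite centre_labelE; case: ifP => // cx.
have : index x (centre_list x) < size (centre_list x).
  by rewrite index_mem mem_centre_list cx; apply: connect0.
by case: blockP => _; lia.
Qed.

Lemma k4_centre_label x : k4_label (centre_label x) = (size (centre_list x) == 4).
Proof.
rewrite /k4_label central_centre_label centre_labelE.
have := @index_mem _ x (centre_list x); rewrite mem_centre_list same_component_refl andbT.
case: blockP => [[_ c _]|_] /=; first by rewrite c ?same_component_refl.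
by case: (central e x) => // /idP; rewrite andbT add0n; lia.
Qed.

Lemma centre_frame : frame centre_slot centre_label.
Proof.
split.
- by move=> k j x; apply/esym/centre_slot_eq/same_component_slot.
- move=> k x; rewrite k4_centre_label centre_labelE.
  have /andP[-> sc] : central e (centre_slot k x) && same_component e x (centre_slot k x).
    by rewrite -mem_centre_list mem_centre_slot.
  rewrite -(centre_list_eq sc) index_uniq ?slot_lt ?centre_list_uniq //.
  have k4 := ltn_ord k; case: blockP => _; rewrite /slot_label //=.
    by congr (_ + _); lia.
  by rewrite -val_eqE /=; case: (nat_of_ord k) => [|[|]].
- move=> x; rewrite central_centre_label => cx.
  have mx : x \in centre_list x by rewrite mem_centre_list cx; apply: connect0.
  rewrite -[RHS](nth_index x mx) /centre_slot /slot_of; congr nth.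
  have := mx; rewrite -index_mem centre_labelE cx.
  by case: blockP => _ h; last rewrite add0n h; rewrite inordK; lia.
- move=> x; rewrite k4_centre_label; case: blockP => // -[a [b [_ _ _ + _]]] _.
  move=> [y [z [yz xy xz cy cz]]].
  exists y, z; rewrite !centre_labelE (negPf cy) (negPf cz); split=> //.
    by apply/esym/centre_slot_eq.
  by apply/esym/centre_slot_eq.
Qed.

Lemma centre_framed_edge : framed_edge centre_slot centre_label e.
Proof.
split=> //.
  move=> x y /and3P[ne /eqP/centre_slot0 xy]; rewrite !central_centre_label.
  case: (blocks x) => [[_ _ adj]|[a [b [_ cE ab _ [adj _]]]]] cxy.
    by apply: adj => //; apply: connect0.
  have mem z : central e z -> same_component e x z -> z \in [set a; b].
    by move=> cz xz; rewrite -cE inE cz.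
  have main u v : central e u -> same_component e x u -> same_component e x v ->
      u != v -> e u v.
    move=> cu xu xv uv; have := mem u cu xu; rewrite !inE.
    have [cv|ncv] := boolP (central e v).
      have := mem v cv xv; rewrite !inE => /orP[]/eqP ev /orP[]/eqP eu;
        by rewrite ev eu ?eqxx // in uv *; rewrite es.
    by have [va vb] := adj v xv ncv; case/orP=> /eqP->; rewrite es.
  have xx : same_component e x x by apply: connect0.
  by case/orP: cxy => c; [apply: main | rewrite es; apply: main; rewrite // eq_sym].
move=> x y z xy xz yz; have cxy := E0_triangle xy xz yz.
rewrite /block_edge (edge_neq ei xy) (centre_slot_eq _ cxy) eqxx !central_centre_label /=.
case: (blocks x) => [[_ c _]|[a [b [_ _ _ _ [_ nadj]]]]].
  by rewrite c //; apply: connect0.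
apply: contraTT xy; rewrite negb_or => /andP[cx cy]; apply: nadj => //; exact: connect0.
Qed.

Lemma centre_decoration : decoration centre_slot centre_label.
Proof.
split; [exact: centre_frame | exact: centre_framed_edge |].
move=> x y /centre_slot0 xy; rewrite !centre_labelE.
have [cx|ncx] := boolP (central e x); last first.
  by have := central_centre_label y; rewrite centre_labelE; case: ifP => // _; lia.
have [cy|ncy] := boolP (central e y); last by move=> _; apply: (adm_central adm).
rewrite -(centre_list_eq xy) ltn_add2l => ixy.
have xl : x \in centre_list x by rewrite mem_centre_list cx; apply: connect0.
have yl : y \in centre_list x by rewrite mem_centre_list cy.
have [rr ra rt tot] := lin; rewrite /vlt /strict_rel.
have -> : x != y by apply: contraTneq ixy => ->; rewrite ltnn.
have srt : sorted (@vle G) (centre_list x) by apply: sort_sorted.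
have := sorted_leq_nth rt rr x srt (index x (centre_list x)) (index y (centre_list x)).
by rewrite !inE !index_mem !nth_index // => -> //; apply: ltnW.
Qed.

End DecorationExists.

Lemma decoration_exists (G : ordered_good_graph) : exists F lab, @decoration G F lab.
Proof. by exists (@centre_slot G), (@centre_label G); apply: centre_decoration. Qed.

(** The three segments of an admissible order: centres of chimneys, K4s,
    non-central vertices. *)
Definition kind (l : 'I_7) : nat := (1 < l) + (5 < l).

Section Decorated.

Variables (G : ordered_good_graph) (F : 'I_4 -> G -> G) (lab : G -> 'I_7).
Hypothesis dec : decoration F lab.

Let fr := dec_frame dec.
Let fe := dec_edge dec.
Let adm : admissible (@edge G) (@vle G) := vle_admissible G.
Let lin : linear_order (@vle G) := adm_linear adm.

Lemma vlt_asym (x y : G) : vlt x y -> vlt y x -> False.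
Proof.
have [_ ra _ _] := lin; move=> /andP[ne xy] /andP[_ yx].
by rewrite (ra x y) ?eqxx ?xy // in ne.
Qed.

Lemma vlt_total (x y : G) : x != y -> vlt x y || vlt y x.
Proof.
have [_ _ _ tot] := lin.
by move=> ne; rewrite /vlt /strict_rel ne eq_sym ne /= tot.
Qed.

Lemma vle_vlt (x y : G) : vle x y = (x == y) || vlt x y.
Proof.
have [rr _ _ _] := lin; rewrite /vlt /strict_rel.
by case: eqVneq => [->|//]; rewrite rr.
Qed.

Lemma same_block_vlt x y : F ord0 x = F ord0 y -> lab x < 6 ->
  vlt x y = (lab x < lab y).
Proof.
move=> exy cx; apply/idP/idP=> [xy|]; last exact: (dec_order dec).
rewrite ltnNge; apply/negP; rewrite leq_eqVlt => /orP[/eqP el|yx].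
  have E := central_lab_inj fr cx exy (ord_inj (esym el)).
  by rewrite E /vlt /strict_rel eqxx in xy.
exact: (vlt_asym xy (dec_order dec (esym exy) yx)).
Qed.

Lemma chimney_partner x : lab x < 2 -> exists2 y,
  chimney_centre (@edge G) x y /\ chimney_centre (@edge G) y x & lab y = 1 - lab x :> nat.
Proof.
move=> cx; have nk4 : ~~ k4_label (lab x) by rewrite /k4_label leqNgt cx.
pose k : 'I_4 := inord (1 - lab x).
have ly : lab (F k x) = 1 - lab x :> nat.
  rewrite (frame_lab fr) (negPf nk4) /slot_label -val_eqE /= inordK; last by lia.
  by case: (lab x : nat) cx => [|[|]].
exists (F k x) => //; split; apply/(chimney_framed fr fe);
  by rewrite (block_act fr) // -val_eqE /= ly; split=> //; lia.
Qed.

Definition usym_label (s : usym) : nat :=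
  match s with R_l => 0 | R_r => 1 | R_K i => 2 + i end.

(** The unary relations of the lift are the labels below 6. *)
Lemma usymR_lab s x : usymR s x <-> lab x = usym_label s :> nat.
Proof.
have chim u v : chimney_centre (@edge G) u v -> vlt u v ->
    lab u = 0 :> nat /\ lab v = 1 :> nat.
  move=> /(chimney_framed fr fe)[euv lu lv]; rewrite -val_eqE /= => ne.
  by rewrite same_block_vlt //; [lia | exact: leq_trans lu _].
have ord u v : chimney_centre (@edge G) u v -> lab u < lab v -> vlt u v.
  by move=> /(chimney_framed fr fe)[euv _ _ _]; apply: (dec_order dec).
case: s => [||i] /=; split.
- by move=> [y xy /chim/(_ xy)[]].
- move=> lx; have [|y [xy _] ly] := @chimney_partner x; first by rewrite lx.
  by exists y => //; apply: ord; rewrite // ly lx.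
- by move=> [y yx /chim/(_ yx)[]].
- move=> lx; have [|y [_ yx] ly] := @chimney_partner x; first by rewrite lx.
  by exists y => //; apply: ord; rewrite // ly lx.
- move=> [f [f_copy f_mono <-]]; have [sb k4] := K4_block fr fe f_copy.
  have mono j k : j < k < 4 -> lab (f (inord j)) < lab (f (inord k)).
    move=> /andP[jk k4']; rewrite -same_block_vlt //; last by case/andP: (k4 (inord j)).
    by apply: f_mono; rewrite !inordK // (ltn_trans jk).
  have /andP[lo _] := k4 (inord 0); have /andP[_ hi] := k4 (inord 3).
  have := mono 0 1 isT; have := mono 1 2 isT; have := mono 2 3 isT.
  rewrite -[in lab (f i)](inord_val i); case: i => [[|[|[|[|]]]] ?] //=; clear - lo hi; lia.
- move=> lx; have k4 : k4_label (lab x) by rewrite /k4_label lx; have := ltn_ord i; lia.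
  exists (F ^~ x); split; first exact: (k4_subgraph fr fe).
    move=> j k jk; apply: (dec_order dec); rewrite ?(block_act fr) //.
    by rewrite !(frame_lab fr) k4 /slot_label ltn_add2l.
  have <- : slot_of (lab x) = i.
    by apply: ord_inj; rewrite /slot_of lx /= inordK ?addKn.
  by apply: (frame_fix fr); rewrite lx; have := ltn_ord i; lia.
Qed.

(** In an admissible order, disjoint intervals of the same kind are ordered as
    the first vertices of their centres: for centres since they are intervals, for
    non-central parts by the last admissibility condition. *)
Lemma vlt_cases x y : vlt x y ->
  [\/ kind (lab x) < kind (lab y),
      kind (lab x) = kind (lab y) /\ (F ord0 x != F ord0 y) && vlt (F ord0 x) (F ord0 y) |
      F ord0 x = F ord0 y /\ lab x <= lab y].
Proof.
move=> xy.
have [exy|nexy] := eqVneq (F ord0 x) (F ord0 y).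
  apply: Or33; split=> //; rewrite leqNgt; apply/negP=> yx.
  exact: (vlt_asym xy (dec_order dec (esym exy) yx)).
have scE := same_component_framed fr fe; have cE := central_framed fr fe.
have mem_slot z : F ord0 z \in centre (@edge G) z.
  by rewrite (centre_framed fr fe); apply/imsetP; exists ord0.
have lin' := lin; case: lin' => rr ra rt tot.
have to_slot : kind (lab x) = kind (lab y) -> vlt (F ord0 x) (F ord0 y).
  move=> ek; have [cx|ncx] := boolP (lab x < 6); last first.
    have ncy : ~~ (lab y < 6).
      by move: ek ncx; rewrite /kind; have := ltn_ord (lab x); have := ltn_ord (lab y); lia.
    rewrite -cE in ncx; rewrite -cE in ncy.
    have nsc : ~~ same_component (@edge G) x y by rewrite scE.
    exact/(adm_noncentral_order adm ncx ncy nsc (mem_slot x) (mem_slot y)).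
  have cy : lab y < 6.
    by move: ek cx; rewrite /kind; have := ltn_ord (lab x); have := ltn_ord (lab y); lia.
  have mem_self z : lab z < 6 -> z \in centre (@edge G) z.
    by move=> cz; rewrite inE cE cz; apply: connect0.
  have notin u v : u \in centre (@edge G) x -> v \in centre (@edge G) y -> u = v -> False.
    rewrite !inE !scE => /andP[_ /eqP eu] /andP[_ /eqP ev] E.
    by rewrite eu ev E eqxx in nexy.
  have vleN (u v : G) : u != v -> ~~ vlt u v -> vle v u.
    by move=> ne /negPf nuv; have := vlt_total ne; rewrite nuv => /andP[].
  have xle : vle x y by case/andP: xy.
  apply: contraT => h; have {h} slots : vle (F ord0 y) (F ord0 x) by apply: vleN.
  case/orP: (tot x (F ord0 y)) => h.
    case: (notin (F ord0 y) (F ord0 y)) => //.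
    exact: (adm_centre adm (mem_self x cx) (mem_slot x) h slots).
  case: (notin x x) => //; first exact: mem_self.
  exact: (adm_centre adm (mem_slot y) (mem_self y cy) h xle).
have [lt|gt|eq] := ltngtP (kind (lab x)) (kind (lab y)); first exact: Or31.
  exfalso; have l7x := ltn_ord (lab x); have l7y := ltn_ord (lab y).
  have [cy|ncy] := boolP (lab y < 6); last by move: gt ncy; rewrite /kind; lia.
  have [cx|ncx] := boolP (lab x < 6); last first.
    by apply: (vlt_asym xy); apply: (adm_central adm); rewrite cE.
  apply: (vlt_asym xy).
  have [|v [cv _] _] := @chimney_partner y; first by move: gt cx cy; rewrite /kind; lia.
  apply: (adm_chimney_K4 adm cv); apply/(in_K4_framed fr fe).
  by move: gt cx cy; rewrite /kind /k4_label; lia.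
by apply: Or32; rewrite to_slot // nexy.
Qed.

End Decorated.

(** * Admissible orders on framed graphs *)

Definition lex_rel (V : Type) (f : V -> nat) (r : rel V) : rel V :=
  fun x y => (f x < f y) || (f x == f y) && r x y.

Lemma lex_rel_linear (V : finType) (f : V -> nat) (r : rel V) :
  linear_order r -> linear_order (lex_rel f r).
Proof.
case=> rr ra rt tot; rewrite /lex_rel; split.
- by move=> x; rewrite eqxx rr orbT.
- move=> x y; have [//|//|/= _ xy] := ltngtP (f x) (f y).
  exact: ra.
- move=> y x z; have [xy _|//|xy /= rxy] := ltngtP (f x) (f y).
    have [yz _|//|yz _] := ltngtP (f y) (f z); first by rewrite (ltn_trans xy yz).
    by rewrite -yz xy.
  by rewrite xy; have [//|//|//= yz] := ltngtP (f y) (f z); apply: rt.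
- move=> x y; have [//|//|/= _] := ltngtP (f x) (f y).
  exact: tot.
Qed.

Lemma lex_rel_between (V : Type) (f : V -> nat) (r : rel V) x y z :
  lex_rel f r x y -> lex_rel f r y z -> f x = f z -> [/\ f y = f x, r x y & r y z].
Proof.
rewrite /lex_rel => + + exz; rewrite -exz.
by have [//|//|->] := ltngtP (f x) (f y).
Qed.

Section BlockOrder.

Variables (V : finType) (F : 'I_4 -> V -> V) (lab : V -> 'I_7) (e : rel V).
Hypotheses (fr : frame F lab) (fe : framed_edge F lab e).
Variable nu : V -> nat.

(** Blocks of one kind are compared by the number of [F 0], the vertices of a
    block by label and number; ranks break the ties. *)
Definition block_order : rel V :=
  lex_rel (fun x => kind (lab x)) (lex_rel (fun x => nu (F ord0 x))
    (lex_rel (fun x => enum_rank (F ord0 x)) (lex_rel (fun x => lab x)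
      (lex_rel nu (fun x y => enum_rank x <= enum_rank y))))).

Lemma block_order_linear : linear_order block_order.
Proof.
do 5!apply: lex_rel_linear.
split=> [x|x y|y x z|x y]; [by []| |exact: leq_trans|exact: leq_total].
by move=> le2; apply: enum_rank_inj; apply: val_inj; apply/eqP; rewrite eqn_leq.
Qed.

Lemma block_order_between x y z : block_order x y -> block_order y z ->
  kind (lab x) = kind (lab z) -> F ord0 x = F ord0 z ->
  kind (lab y) = kind (lab x) /\ F ord0 y = F ord0 x.
Proof.
move=> xy yz ek eF; have [-> {}xy {}yz] := lex_rel_between xy yz ek.
have [|_ {}xy {}yz] := lex_rel_between xy yz; first by rewrite eF.
have [|/ord_inj/enum_rank_inj] := lex_rel_between xy yz; first by rewrite eF.
by [].
Qed.

Definition block_lt : rel V := fun a b =>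
  (nu a < nu b) || (nu a == nu b) && (enum_rank a < enum_rank b).

(** For vertices of different blocks the order is decided at the vertices
    [F 0], in the same way for central and non-central vertices. *)
Lemma block_order_diff x y : kind (lab x) = kind (lab y) -> F ord0 x != F ord0 y ->
  block_order x y = block_lt (F ord0 x) (F ord0 y).
Proof.
move=> ek ne; rewrite /block_order /lex_rel ek ltnn eqxx /= /block_lt.
have -> : (enum_rank (F ord0 x) == enum_rank (F ord0 y) :> nat) = false.
  by apply/negbTE; apply: contraNneq ne => /ord_inj/enum_rank_inj->.
by rewrite orbF.
Qed.

Lemma block_order_kind x y : kind (lab x) < kind (lab y) -> strict_rel block_order x y.
Proof.
move=> lt; rewrite /strict_rel /block_order /lex_rel lt andbT.
by apply: contraTneq lt => ->; rewrite ltnn.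
Qed.

Lemma kind_leq (l l' : 'I_7) : l <= l' -> kind l <= kind l'.
Proof. by rewrite /kind; lia. Qed.

Lemma block_order_lab x y : F ord0 x = F ord0 y -> lab x < lab y ->
  strict_rel block_order x y.
Proof.
move=> eF lt; have := kind_leq (ltnW lt); rewrite leq_eqVlt => /orP[/eqP ek|]; last first.
  exact: block_order_kind.
rewrite /strict_rel /block_order /lex_rel ek eF !ltnn !eqxx /= lt andbT.
by apply: contraTneq lt => ->; rewrite ltnn.
Qed.

Lemma block_order_mono x y :
  [\/ kind (lab x) < kind (lab y),
      kind (lab x) = kind (lab y) /\ nu (F ord0 x) < nu (F ord0 y) |
      [/\ F ord0 x = F ord0 y, lab x <= lab y & nu x < nu y]] -> block_order x y.
Proof.
case=> [/block_order_kind/andP[]//|[ek lt]|[eF]].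
  by rewrite /block_order /lex_rel ek ltnn eqxx lt.
rewrite leq_eqVlt => /orP[/eqP el lt|/(block_order_lab eF)/andP[]//].
by rewrite /block_order /lex_rel (ord_inj el) eF !ltnn !eqxx /= lt.
Qed.

Lemma block_order_admissible : admissible e block_order.
Proof.
have cE := central_framed fr fe; have scE := same_component_framed fr fe.
have kind_central x y : F ord0 x = F ord0 y -> lab x < 6 -> lab y < 6 ->
    kind (lab x) = kind (lab y).
  by move=> /(same_block_k4 fr); rewrite /kind /k4_label; lia.
split.
- exact: block_order_linear.
- move=> v x y z; rewrite !inE !cE !scE => /andP[cx /eqP ex] /andP[cz /eqP ez] xy yz.
  have exz : F ord0 x = F ord0 z by rewrite -ex -ez.
  have [ek ey] := block_order_between xy yz (kind_central _ _ exz cx cz) exz.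
  rewrite ey ex eqxx andbT; move: ek cx; rewrite /kind; have := ltn_ord (lab y); lia.
- move=> u v w /(chimney_framed fr fe)[_ lu _ _] /(in_K4_framed fr fe) kw.
  apply: block_order_kind; move: kw; rewrite /kind /k4_label; lia.
- move=> u v; rewrite !cE => cu cv; apply: block_order_kind; rewrite /kind.
  by have := ltn_ord (lab v); lia.
- move=> v x y z; rewrite !inE !cE !scE => /andP[cx /eqP ex] /andP[cz /eqP ez] xy yz.
  have exz : F ord0 x = F ord0 z by rewrite -ex -ez.
  have kx : kind (lab x) = kind (lab z).
    by rewrite /kind; have := ltn_ord (lab x); have := ltn_ord (lab z); lia.
  have [ek ey] := block_order_between xy yz kx exz.
  rewrite ey ex eqxx andbT; move: ek cx; rewrite /kind; have := ltn_ord (lab y); lia.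
- move=> u v x y; rewrite !cE !scE !inE !cE !scE.
  move=> cu cv ne /andP[cx /eqP ex] /andP[cy /eqP ey].
  have kuv : kind (lab u) = kind (lab v).
    by rewrite /kind; have := ltn_ord (lab u); have := ltn_ord (lab v); lia.
  have kxy : kind (lab x) = kind (lab y).
    have := same_block_k4 fr ex; have := same_block_k4 fr ey.
    by move: cu cv cx cy; rewrite /kind /k4_label; lia.
  have nxy : F ord0 x != F ord0 y by rewrite -ex -ey.
  have nF a b : F ord0 a != F ord0 b -> a != b by apply: contraNneq => ->.
  rewrite /strict_rel (nF u v ne) (nF x y nxy).
  by rewrite (block_order_diff kuv ne) (block_order_diff kxy nxy) ex ey.
Qed.

Definition block_graph : ordered_good_graph :=
  OrderedGoodGraph (framed_sym fe) (framed_irr fe) (framed_bowtie_free fr fe)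
    (framed_good fr fe) block_order_admissible.

Lemma block_graph_decoration : @decoration block_graph F lab.
Proof. by split=> // x y; apply: block_order_lab. Qed.

End BlockOrder.

(** * The Ramsey property for closed subsets of a good graph *)

Lemma E1_sym (V : finType) (e : rel V) : symmetric e -> symmetric (E1 e).
Proof. by move=> es x y; rewrite /E1 es (E0_sym es). Qed.

(** Preserving the maps and labels makes centres go to centres. *)
Record graph_embedding (G H : ordered_good_graph) (F : 'I_4 -> G -> G)
    (lab : G -> 'I_7) (F' : 'I_4 -> H -> H) (lab' : H -> 'I_7) (f : G -> H) : Prop :=
  GraphEmbedding {
  gemb_inj : injective f;
  gemb_act : equivariant F F' f;
  gemb_lab : forall x, lab' (f x) = lab x;
  gemb_edge : {mono f : x y / edge x y};
  gemb_lt : {mono f : x y / vlt x y} }.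

(** [X1] and [X2] are the outcomes of the two stages. The vertices of the graph
    are the points of [X2] on copies of [G]; an edge of E_1 is a pair that is
    related in [X2] and lies over an edge of [X1]. *)
Section CoveredGraph.

Variables (G : ordered_good_graph) (F : 'I_4 -> G -> G) (lab : G -> 'I_7).
Hypothesis dec : decoration F lab.
Let fr := dec_frame dec.
Let fe := dec_edge dec.

Variables (n : nat) (X1 : system (@numbered_act 'I_4 'I_7 n))
  (X2 : system (@act _ _ _ X1)).

Definition flag_lift (b0 : {ffun G -> numbered 'I_4 'I_7 n}) (b1 : {ffun G -> X1})
    (b2 : {ffun G -> X2}) : Prop :=
  [/\ numberings n F lab (@vle G) b0, is_lift F (E1 (@edge G)) b0 b1 &
      is_lift F (fun _ _ => true) b1 b2].

Hypothesis tri : forall x y z : X2, triangle x y z -> exists b0 b1 p q r,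
  [/\ numberings n F lab (@vle G) b0, is_lift F (E1 (@edge G)) b0 b1,
      proj x = b1 p, proj y = b1 q & proj z = b1 r].

Definition covered (x : X2) : bool :=
  decide_prop (exists b0 b1 b2 p, flag_lift b0 b1 b2 /\ x = b2 p).

Lemma covered_lift b0 b1 b2 p : flag_lift b0 b1 b2 -> covered (b2 p).
Proof. by move=> h; apply/decide_propP; exists b0, b1, b2, p. Qed.

Lemma covered_act k x : covered x -> covered (act k x).
Proof.
case/decide_propP=> b0 [b1 [b2 [p [h ->]]]]; have [_ _ /liftP[_ <- _]] := h.
exact: covered_lift h.
Qed.

Let W : finType := {x : X2 | covered x}.

Definition cov_act (k : 'I_4) (w : W) : W :=
  exist _ (act k (val w)) (covered_act k (valP w)).

Definition cov_lab (w : W) : 'I_7 := root_label (proj (proj (val w))).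

Definition cov_num (w : W) : nat := root_number (proj (proj (val w))).

(** Both directions are required to make the relation symmetric, which is not
    built into systems. *)
Definition cov_E1 : rel W := fun x y =>
  [&& adj (val x) (val y), adj (val y) (val x),
      adj (proj (val x)) (proj (val y)) & adj (proj (val y)) (proj (val x))].

Definition cov_edge : rel W := fun x y => block_edge cov_act cov_lab x y || cov_E1 x y.

Definition cov_inst b0 b1 b2 (h : flag_lift b0 b1 b2) (p : G) : W :=
  exist _ (b2 p) (covered_lift p h).

(** Every vertex is the image of a vertex of [G] under an embedding: this
    transfers to the covered graph each law about a single vertex and its
    images. *)
Lemma cov_instP (w : W) : exists b0 b1 b2 (h : flag_lift b0 b1 b2) p, w = cov_inst h p.
Proof.
have /decide_propP[b0 [b1 [b2 [p [h e]]]]] := valP w.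
by exists b0, b1, b2, h, p; apply: val_inj.
Qed.

Section Instance.

Variables (b0 : {ffun G -> numbered 'I_4 'I_7 n}) (b1 : {ffun G -> X1}).
Variable b2 : {ffun G -> X2}.
Hypothesis h : flag_lift b0 b1 b2.

Lemma lift_inj : injective b1.
Proof.
have [/numberingsP[b_inj _ _ _] /liftP[l1 _ _] _] := h.
by move=> p q /(congr1 (@proj _ _ _ _)); rewrite !l1 => /b_inj.
Qed.

Lemma proj_inst p : proj (val (cov_inst h p)) = b1 p.
Proof. by have [_ _ /liftP[l1 _ _]] := h; rewrite /= l1. Qed.

Lemma inst_inj : injective (cov_inst h).
Proof.
by move=> p q /(congr1 (fun w => proj (val w))); rewrite !proj_inst => /lift_inj.
Qed.

Lemma inst_act : equivariant F cov_act (cov_inst h).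
Proof. by move=> k p; apply: val_inj; have [_ _ /liftP[_ l2 _]] := h; rewrite /= l2. Qed.

Lemma inst_lab p : cov_lab (cov_inst h p) = lab p.
Proof.
have [/numberingsP[_ _ b3 _] /liftP[l1 _ _] _] := h.
by rewrite /cov_lab proj_inst l1 b3.
Qed.

Lemma inst_num p q : vlt p q -> cov_num (cov_inst h p) < cov_num (cov_inst h q).
Proof.
have [/numberingsP[_ _ _ b4] /liftP[l1 _ _] _] := h.
by rewrite /cov_num !proj_inst !l1; apply: b4.
Qed.

Lemma inst_adj p q : adj (val (cov_inst h p)) (val (cov_inst h q)).
Proof. by have [_ _ /liftP[_ _ ->]] := h. Qed.

Lemma inst_E1 p q : cov_E1 (cov_inst h p) (cov_inst h q) = E1 (@edge G) p q.
Proof.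
rewrite /cov_E1 !inst_adj !proj_inst; have [_ /liftP[_ _ l3] _] := h.
by rewrite !l3 [E1 _ q p](E1_sym (@edge_sym G)) andbb.
Qed.

Lemma inst_block p q :
  block_edge cov_act cov_lab (cov_inst h p) (cov_inst h q) = block_edge F lab p q.
Proof. by rewrite /block_edge !inst_lab -!inst_act !(inj_eq inst_inj). Qed.

Lemma inst_edge p q : cov_edge (cov_inst h p) (cov_inst h q) = edge p q.
Proof.
rewrite /cov_edge inst_block inst_E1 /E1 -(E0_framed fr fe) /E0.
by case: (edge p q) => //=; case: existsP.
Qed.

End Instance.

Lemma cov_frame : frame cov_act cov_lab.
Proof.
split.
- move=> k j w; have [b0 [b1 [b2 [h [p ->]]]]] := cov_instP w.
  by rewrite -!inst_act (frame_act fr).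
- move=> k w; have [b0 [b1 [b2 [h [p ->]]]]] := cov_instP w.
  by rewrite -!inst_act !inst_lab (frame_lab fr).
- move=> w; have [b0 [b1 [b2 [h [p ->]]]]] := cov_instP w.
  by rewrite !inst_lab -!inst_act => c; rewrite (frame_fix fr).
- move=> w; have [b0 [b1 [b2 [h [p ->]]]]] := cov_instP w.
  rewrite !inst_lab => /(frame_leaves fr)[y [z [yz ly lz ey ez]]].
  exists (cov_inst h y), (cov_inst h z).
  by rewrite !inst_lab -!inst_act (inj_eq (@inst_inj _ _ _ h)) ey ez.
Qed.

Lemma cov_act_adj k w : adj (val w) (val (cov_act k w)) && adj (val (cov_act k w)) (val w).
Proof.
by have [b0 [b1 [b2 [h [p ->]]]]] := cov_instP w; rewrite -inst_act !inst_adj.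
Qed.

Lemma cov_edge_adj x y : cov_edge x y -> adj (val x) (val y).
Proof.
case/orP=> [/(block_edge_slot cov_frame)[k [->|->]]|/and4P[]//].
  by case/andP: (cov_act_adj k y).
by case/andP: (cov_act_adj k x).
Qed.

Lemma proj_act_inj k w : proj (val (cov_act k w)) = proj (val w) -> cov_act k w = w.
Proof.
have [b0 [b1 [b2 [h [p ->]]]]] := cov_instP w.
by rewrite -inst_act !proj_inst => /(lift_inj h)->.
Qed.

(** An edge that lies over a copy of [G] in [X1] comes from an edge of [G]. For an
    edge of a block this holds since one of its ends is the image of the other
    under some [F k], and [b1] commutes with [F k]. *)
Lemma cov_edge_base b0 b1 x y p q :
  numberings n F lab (@vle G) b0 -> is_lift F (E1 (@edge G)) b0 b1 ->
  proj (val x) = b1 p -> proj (val y) = b1 q -> cov_edge x y -> edge p q.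
Proof.
move=> /numberingsP[b_inj _ _ _] /liftP[l1 l2 l3] xp yq.
have b1_inj : injective b1.
  by move=> u v /(congr1 (@proj _ _ _ _)); rewrite !l1 => /b_inj.
have slot k u v w w' : u = cov_act k v -> proj (val u) = b1 w -> proj (val v) = b1 w' ->
    u != v -> edge w' w.
  move=> -> /= uw vw uv; have ew : w = F k w' by apply: b1_inj; rewrite -uw proj_act vw l2.
  rewrite ew; apply: (framed_block fe); apply: (block_edge_act fr).
  apply: contraNneq uv => e; apply/eqP/proj_act_inj; rewrite /= proj_act vw.
  by rewrite -l2 e.
case/orP=> [xy|/and4P[_ _ + _]]; last by rewrite xp yq l3 => /andP[].
have /and3P[ne _ _] := xy; have [k [E|E]] := block_edge_slot cov_frame xy.
  by rewrite edge_sym; apply: slot E xp yq ne.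
by rewrite eq_sym in ne; apply: slot E yq xp ne.
Qed.

(** Edges are related in [X2], so a triangle projects to a triangle of a copy of
    [G] in [X1]; in [G] an edge of E_1 is in no triangle. *)
Lemma cov_framed_edge : framed_edge cov_act cov_lab cov_edge.
Proof.
have cov_sym : symmetric cov_edge.
  move=> x y; rewrite /cov_edge block_edge_sym; congr orb.
  by rewrite /cov_E1; apply/and4P/and4P=> -[].
split=> //.
- move=> w; have [b0 [b1 [b2 [h [p ->]]]]] := cov_instP w.
  by rewrite inst_edge edge_irr.
- by move=> x y xy; rewrite /cov_edge xy.
move=> x y z xy xz yz; case/orP: (xy) => // /and4P[_ _ xyE _]; exfalso.
have [|b0 [b1 [p [q [r [bb0 l1 xp yq zr]]]]]] := @tri (val x) (val y) (val z).
  by rewrite /triangle !cov_edge_adj.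
have pr := cov_edge_base bb0 l1 xp zr xz; have qr := cov_edge_base bb0 l1 yq zr yz.
have /liftP[_ _ l3] := l1.
move: xyE; rewrite xp yq l3 /E1 /E0 => /andP[->] /= /existsP; apply.
by exists r; rewrite pr.
Qed.

Definition covered_graph : ordered_good_graph :=
  block_graph cov_frame cov_framed_edge cov_num.

Lemma covered_graph_decoration : @decoration covered_graph cov_act cov_lab.
Proof. exact: block_graph_decoration. Qed.

Lemma inst_embedding b0 b1 b2 (h : flag_lift b0 b1 b2) :
  @graph_embedding G covered_graph F lab cov_act cov_lab (cov_inst h).
Proof.
have lt p q : vlt p q -> @vlt covered_graph (cov_inst h p) (cov_inst h q).
  move=> pq; have /andP[ne _] := pq.
  rewrite /vlt /strict_rel (inj_eq (@inst_inj _ _ _ h)) ne /=.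
  apply: block_order_mono; rewrite !inst_lab -!inst_act.
  have [?|[? /andP[_ /inst_num lt]]|[E ?]] := vlt_cases dec pq.
  - exact: Or31.
  - by apply: Or32.
  - by apply: Or33; rewrite E; split=> //; apply: inst_num.
split; [exact: inst_inj|exact: inst_act|exact: inst_lab|exact: inst_edge|].
move=> p q; apply/idP/idP=> [pq|]; last exact: lt.
have /andP[ne _] := pq; rewrite (inj_eq (@inst_inj _ _ _ h)) in ne.
by have /orP[//|/lt/(vlt_asym pq)] := vlt_total ne.
Qed.

End CoveredGraph.

Section GoodGraphRamsey.

Variables (G : ordered_good_graph) (F : 'I_4 -> G -> G) (lab : G -> 'I_7).
Hypothesis dec : decoration F lab.
Variable S : {set G}.
Hypothesis S_act : forall k x, x \in S -> F k x \in S.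

Definition sub_act (k : 'I_4) (s : {x | x \in S}) : {x | x \in S} :=
  exist _ (F k (val s)) (S_act k (valP s)).

Definition sub_copy (c : {ffun {x | x \in S} -> G}) : Prop :=
  ordered_copy sub_act F (fun s => lab (val s)) lab
    (fun s s' => @vle G (val s) (val s')) (@vle G)
    (fun s s' => E1 (@edge G) (val s) (val s')) (E1 (@edge G)) c.

Theorem good_graph_ramsey (C : finType) (c0 : C) :
  exists (H : ordered_good_graph) F' lab', @decoration H F' lab' /\
  forall chi : {ffun {x | x \in S} -> H} -> C,
  exists2 f : G -> H, graph_embedding F lab F' lab' f &
  forall c c', sub_copy c -> sub_copy c' ->
    chi (ffun_comp f c) = chi (ffun_comp f c').
Proof.
have lin : linear_order (@vle G) := adm_linear (vle_admissible G).
have [rr ra rt tot] := lin.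
have linS : linear_order (fun s s' : {x | x \in S} => @vle G (val s) (val s')).
  split=> [s|s s' le2|s s' s''|s s']; [exact: rr| |exact: rt|exact: tot].
  by apply: val_inj; apply: ra.
have [n [X1 [X2 [tri mono]]]] := @ordered_ramsey _ _ _ _ sub_act F
  (fun s => lab (val s)) lab _ _ (fun s s' => E1 (@edge G) (val s) (val s'))
  (E1 (@edge G)) linS lin (frame_act (dec_frame dec)) _ c0.
exists (covered_graph dec tri), (@cov_act _ _ _ _ _ _), (@cov_lab _ _ _ _ _ _); split.
  exact: covered_graph_decoration.
move=> chi.
(* Maps that leave the covered points get a default colour. *)
pose chi' (l : {ffun {x | x \in S} -> X2}) : C :=
  if [pick l' : {ffun {x | x \in S} -> {x : X2 | covered F lab x}} |
      ffun_comp val l' == l] is Some l' then chi l' else c0.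
have [b0 [b1 [b2 [bb0 l1 l2 chi'_mono]]]] := mono chi'.
have h : flag_lift F lab b0 b1 b2 by [].
exists (cov_inst h); first exact: inst_embedding.
have chiE c : chi (ffun_comp (cov_inst h) c) = chi' (ffun_comp b2 c).
  rewrite /chi'; case: pickP => [l' /eqP e|/(_ (ffun_comp (cov_inst h) c))/eqP[]].
    congr chi; apply/ffunP=> s; apply: val_inj; move/ffunP/(_ s): e.
    by rewrite !ffunE /= => ->.
  by apply/ffunP=> s; rewrite !ffunE.
by move=> c c' cc cc'; rewrite !chiE; apply: chi'_mono.
Qed.

End GoodGraphRamsey.

(** * Types of pairs and closures of copies *)

Record structure_embedding (L : lang) (M N : structure L) (f : M -> N) : Prop :=
  StructureEmbedding {
  semb_inj : injective f;
  semb_un : forall s x, unR s x <-> unR s (f x);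
  semb_bin : forall s x y, binR s x y <-> binR s (f x) (f y) }.

Section Structures.

Variable L : lang.
Implicit Types M N P : structure L.

Lemma isomorphism_embedding M N (f : M -> N) : isomorphism f -> structure_embedding f.
Proof. by case=> /bij_inj. Qed.

Lemma isomorphic_sym M N : isomorphic M N -> isomorphic N M.
Proof.
case=> f fi; have [[g fK gK] _ _] := fi.
by exists g; apply: isomorphism_inv fi fK gK.
Qed.

Lemma structure_embedding_comp M N P (f : M -> N) (g : N -> P) :
  structure_embedding f -> structure_embedding g -> structure_embedding (g \o f).
Proof.
case=> f1 f2 f3 [g1 g2 g3]; split=> [|s x|s x y] /=; first exact: inj_comp.
  by rewrite f2 g2.
by rewrite f3 g3.
Qed.

Lemma induced_embedding M (S : {set M}) :
  structure_embedding (fun x : induced S => val x : M).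
Proof. by split=> //; apply: val_inj. Qed.

Lemma induced_image M N (f : M -> N) (S : {set M}) (T : {set N}) :
  structure_embedding f -> T = f @: S ->
  exists2 g : induced S -> induced T, isomorphism g & forall x, val (g x) = f (val x).
Proof.
move=> [f1 f2 f3] ET.
have memT (x : induced S) : f (val x) \in T.
  by rewrite ET; apply: imset_f; apply: valP.
pose g (x : induced S) : induced T := exist _ (f (val x)) (memT x).
exists g => //; split.
- apply: inj_card_bij; first by move=> x y /(congr1 val) /= /f1/val_inj.
  by rewrite /= !card_sig ET; apply: leq_imset_card.
- by move=> s x; apply: f2.
- by move=> s x y; apply: f3.
Qed.

Lemma image_copy M N (f : M -> N) : structure_embedding f -> is_copy M (f @: setT).
Proof.
move=> ef; apply: isomorphic_sym.
have [f1 f2 f3] := ef.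
have memT x : f x \in f @: setT by apply: imset_f.
exists (fun x => exist _ (f x) (memT x) : induced (f @: setT)); split=> //.
apply: inj_card_bij; first by move=> x y /(congr1 val) /= /f1.
by rewrite /= card_sig card_imset ?cardsT.
Qed.

Lemma copy_embedding M N (T : {set N}) : is_copy M T ->
  exists2 f : M -> N, structure_embedding f & f @: setT = T.
Proof.
move=> /isomorphic_sym[g gi]; have [[g' gK g'K] _ _] := gi.
exists (fun x => val (g x)).
  exact: (structure_embedding_comp (isomorphism_embedding gi) (@induced_embedding N T)).
apply/setP=> y; apply/imsetP/idP=> [[x _ ->]|yT]; first exact: valP.
by exists (g' (exist _ y yT)); rewrite // g'K.
Qed.

End Structures.

Lemma rooted_isomorphic_trans (R S T : rooted) :
  rooted_isomorphic R S -> rooted_isomorphic S T -> rooted_isomorphic R T.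
Proof.
move=> [f [[f0 f1 f2] fr1 fr2]] [g [[g0 g1 g2] gr1 gr2]].
exists (g \o f); split; [split=> [|s x|s x y] /=|by rewrite /= fr1|by rewrite /= fr2].
- exact: bij_comp.
- by rewrite f1.
- by rewrite f2.
Qed.

Lemma Bbar_embedding N (t : 'I_N -> rooted) M : Bbar t M ->
  exists G : ordered_good_graph, exists f : M -> L2 t G, structure_embedding f.
Proof.
move=> [H [G [g gi]] [S [h hi]]]; exists G, (g \o (fun x : induced S => val x) \o h).
apply: structure_embedding_comp; first exact: isomorphism_embedding hi.
by apply: structure_embedding_comp (isomorphism_embedding gi); apply: induced_embedding.
Qed.

Lemma Bbar_L2 N (t : 'I_N -> rooted) G : Bbar t (L2 t G).
Proof.
exists (L2 t G); first by exists G, id; apply: isomorphism_refl.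
exists (id @: setT); apply: isomorphic_sym; apply: (image_copy (f := id)).
by split.
Qed.

Section GraphEmbeddings.

Variables (G H : ordered_good_graph) (F : 'I_4 -> G -> G) (lab : G -> 'I_7).
Variables (F' : 'I_4 -> H -> H) (lab' : H -> 'I_7).
Hypotheses (dec : decoration F lab) (dec' : decoration F' lab').
Variable f : G -> H.
Hypothesis ef : graph_embedding F lab F' lab' f.

Lemma graph_embedding_E0 x y : E0 (@edge H) (f x) (f y) = E0 (@edge G) x y.
Proof.
rewrite (E0_framed (dec_frame dec) (dec_edge dec)).
rewrite (E0_framed (dec_frame dec') (dec_edge dec')).
have [f1 f2 f3 _ _] := ef.
by rewrite /block_edge !f3 -!f2 !(inj_eq f1).
Qed.

Lemma graph_embedding_L1 : @structure_embedding lang1 (L1 G) (L1 H) f.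
Proof.
have [f1 f2 f3 f4 f5] := ef.
split=> // [s x|[] x y] /=.
- rewrite -/(usymR s x) -/(usymR s (f x)) (usymR_lab dec) (usymR_lab dec').
  by rewrite f3.
- by rewrite graph_embedding_E0.
- by rewrite /E1 graph_embedding_E0 f4.
- by rewrite !vle_vlt f5 (inj_eq f1).
Qed.

Lemma graph_embedding_support x y :
  type_support (f x) (f y) = f @: type_support x y.
Proof.
have [f1 f2 _ _ _] := ef.
have centreE z : centre (@edge H) (f z) = f @: centre (@edge G) z.
  rewrite (centre_framed (dec_frame dec) (dec_edge dec)).
  rewrite (centre_framed (dec_frame dec') (dec_edge dec')) -imset_comp.
  by apply: eq_imset => k /=; rewrite f2.
by rewrite /type_support !imsetU !imset_set1 !centreE.
Qed.

(** The vertices that a type sees are the two roots and their centres, which an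
    embedding preserves. *)
Lemma graph_embedding_pair_type x y :
  rooted_isomorphic (pair_type x y) (pair_type (f x) (f y)).
Proof.
have [g gi gE] := induced_image graph_embedding_L1 (graph_embedding_support x y).
by exists g; split=> //; apply: val_inj; rewrite gE.
Qed.

Lemma graph_embedding_L2 N (t : 'I_N -> rooted) :
  @structure_embedding (lang2 N) (L2 t G) (L2 t H) f.
Proof.
have [f1 f2 f3] := graph_embedding_L1.
split=> // [[s|i] x y] /=; first exact: (f3 s).
rewrite (gemb_lt ef); split=> -[xy ti]; split=> //.
  exact: rooted_isomorphic_trans ti (graph_embedding_pair_type x y).
exact: rooted_isomorphic_trans ti (rooted_isomorphic_sym (graph_embedding_pair_type x y)).
Qed.

End GraphEmbeddings.

Section Closure.

Variables (N : nat) (t : 'I_N -> rooted).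
Hypothesis ht : type_enumeration t.
Variables (G : ordered_good_graph) (F : 'I_4 -> G -> G) (lab : G -> 'I_7).
Hypothesis dec : decoration F lab.
Let fr := dec_frame dec.
Let fe := dec_edge dec.

(** The data of a pair that an extension of an embedding to the closure has to
    preserve, besides the labels. *)
Record same_pair (u v u' v' : G) : Prop := SamePair {
  same_pair_eq : (u == v) = (u' == v');
  same_pair_lt : vlt u v = vlt u' v';
  same_pair_gt : vlt v u = vlt v' u';
  same_pair_E1 : E1 (@edge G) u v = E1 (@edge G) u' v' }.

Lemma same_pair_sym u v u' v' : same_pair u v u' v' -> same_pair v u v' u'.
Proof.
case=> e l g E; split=> //; first by rewrite eq_sym e eq_sym.
by rewrite (E1_sym (@edge_sym G)) E (E1_sym (@edge_sym G)).
Qed.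

(** The label 6 is the absence of all marks. *)
Lemma same_marks_lab x x' :
  (forall s, @usymR G s x <-> usymR s x') -> lab x = lab x'.
Proof.
move=> h; have {}h s : lab x = usym_label s :> nat <-> lab x' = usym_label s :> nat.
  by rewrite -!(usymR_lab dec).
have mark (l : 'I_7) : l < 6 -> exists s, l = usym_label s :> nat.
  move=> l6; have [l0|l0] := boolP (l == 0 :> nat); first by exists R_l; apply/eqP.
  have [l1|l1] := boolP (l == 1 :> nat); first by exists R_r; apply/eqP.
  have l2 : l - 2 < 4 by lia.
  by exists (R_K (Ordinal l2)) => /=; lia.
apply: ord_inj.
have [/mark[s ls]|lx] := boolP (lab x < 6); first by rewrite ls; apply/esym/h.
have [/mark[s ls]|lx'] := boolP (lab x' < 6); first by rewrite ls; apply/h.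
by have := ltn_ord (lab x); have := ltn_ord (lab x'); lia.
Qed.

(** An isomorphism of types maps [F k x] to [F k x'], since [F k x] is the vertex
    with its mark that equals [x] or is joined to [x] by an edge of E_0. *)
Lemma same_pair_of_type x y x' y' o o' : x != y ->
  rooted_isomorphic (pair_type x y) (pair_type x' y') -> lab x = lab x' -> lab y = lab y' ->
  same_pair (act_opt F o x) (act_opt F o' y) (act_opt F o x') (act_opt F o' y').
Proof.
move=> nxy [g [gi g1 g2]] lx ly; have [g_bij g_un g_bin] := gi.
have slot_in (k : 'I_4) z : F k z \in centre (@edge G) z.
  by rewrite (centre_framed fr fe); apply/imsetP; exists k.
have in1 p : act_opt F p x \in type_support x y.
  case: p => [k|] /=; rewrite !inE ?eqxx //.
  by have := slot_in k x; rewrite inE => ->; rewrite orbT.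
have in2 p : act_opt F p y \in type_support x y.
  case: p => [k|] /=; rewrite !inE ?eqxx ?orbT //.
  by have := slot_in k y; rewrite inE => ->; rewrite orbT.
pose pt w (win : w \in type_support x y) : pair_type x y :=
  exist (fun z => z \in type_support x y) w win.
have g_slot p (r : pair_type x y) (r' : G)
    (zin : act_opt F p (val r) \in type_support x y) :
    val (g r) = r' -> lab (val r) = lab r' -> val (g (pt _ zin)) = act_opt F p r'.
  move=> gr lr; case: p zin => [k|] /= zin; last first.
    by rewrite (_ : pt _ zin = r) //; apply: val_inj.
  set w := g _; pose z := pt _ zin.
  have lw : lab (val w) = lab (F k r').
    have -> : lab (val w) = lab (F k (val r)).
      by apply/esym/same_marks_lab => s; apply: (g_un s z).
    by apply: ord_inj; rewrite !(frame_lab fr) lr.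
  have bw : F ord0 (val w) = F ord0 r'.
    have [e|ne] := eqVneq (F k (val r)) (val r).
      have -> : w = g r by rewrite /w; congr g; apply: val_inj.
      by rewrite gr.
    have : @binR lang1 (pair_type x y) R_E0 r z.
      by rewrite /= (E0_framed fr fe); apply: (block_edge_act fr).
    by move/(g_bin R_E0 r z); rewrite /= (E0_framed fr fe) gr => /same_block.
  apply: (central_lab_inj fr) => //; first by rewrite lw (lab_act_lt fr).
  by rewrite (block_act fr).
have gu := g_slot o (root1 (pair_type x y)) x' (in1 o) (congr1 val g1) lx.
have gv := g_slot o' (root2 (pair_type x y)) y' (in2 o') (congr1 val g2) ly.
move: gu gv; set u := pt _ (in1 o); set v := pt _ (in2 o') => gu gv.
have eqE (a b : pair_type x y) : (val a == val b) = (val (g a) == val (g b)).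
  by rewrite !(inj_eq val_inj) (bij_eq g_bij).
have leE (a b : pair_type x y) : vle (val a) (val b) = vle (val (g a)) (val (g b)).
  by apply/idP/idP=> /(g_bin R_le a b).
have ltE (a b : pair_type x y) : vlt (val a) (val b) = vlt (val (g a)) (val (g b)).
  by rewrite /vlt /strict_rel eqE leE.
rewrite -gu -gv -[act_opt F o x]/(val u) -[act_opt F o' y]/(val v); split=> //.
by apply/idP/idP=> /(g_bin R_E1 u v).
Qed.

(** Inside the closure of one vertex everything is determined by labels. *)
Lemma same_pair_of_lab x x' o o' : lab x = lab x' ->
  same_pair (act_opt F o x) (act_opt F o' x) (act_opt F o x') (act_opt F o' x').
Proof.
move=> lx.
have lab_opt p : lab (act_opt F p x) = lab (act_opt F p x').
  by case: p => //= k; apply: ord_inj; rewrite !(frame_lab fr) lx.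
have block_opt p z : F ord0 (act_opt F p z) = F ord0 z.
  by case: p => //= k; rewrite (block_act fr).
have [nn|leaf] := boolP ((lab (act_opt F o x) < 6) || (lab (act_opt F o' x) < 6)); last first.
  have noneE p : ~~ (lab (act_opt F p x) < 6) -> p = None.
    by case: p => //= k; rewrite (lab_act_lt fr).
  move: leaf; rewrite negb_or => /andP[/noneE-> /noneE->] /=.
  have E1xx z : E1 (@edge G) z z = false by rewrite /E1 edge_irr.
  by split; rewrite ?eqxx ?E1xx // /vlt /strict_rel !eqxx.
have lt_lab z p q : F ord0 (act_opt F p z) = F ord0 (act_opt F q z) ->
    (lab (act_opt F p z) < 6) || (lab (act_opt F q z) < 6) ->
    vlt (act_opt F p z) (act_opt F q z) = (lab (act_opt F p z) < lab (act_opt F q z)).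
  move=> e /orP[c|c]; first exact: (same_block_vlt dec).
  apply/idP/idP=> [lt|]; last exact: (dec_order dec).
  rewrite ltnNge leq_eqVlt; apply/negP=> /orP[/eqP el|gt].
    have E := central_lab_inj fr c (esym e) (ord_inj el).
    by rewrite E /vlt /strict_rel eqxx in lt.
  exact: (vlt_asym lt (dec_order dec (esym e) gt)).
have eq_lab z p q : F ord0 (act_opt F p z) = F ord0 (act_opt F q z) ->
    (lab (act_opt F p z) < 6) || (lab (act_opt F q z) < 6) ->
    (act_opt F p z == act_opt F q z) = (lab (act_opt F p z) == lab (act_opt F q z)).
  move=> e /orP[c|c]; apply/eqP/eqP=> [->//|el].
    exact: (central_lab_inj fr c).
  by apply/esym; apply: (central_lab_inj fr c).
have bb z p q : F ord0 (act_opt F p z) = F ord0 (act_opt F q z) by rewrite !block_opt.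
have nn' := nn; rewrite orbC in nn'.
split; rewrite ?lt_lab ?eq_lab -?lab_opt //.
have E1F z : E1 (@edge G) (act_opt F o z) (act_opt F o' z) = false.
  by rewrite /E1 (E0_framed fr fe) (framed_same_block fr fe) // -(block_edge_lab fr) ?andbN.
by rewrite !E1F.
Qed.

Variables (A : structure (lang2 N)) (f f' : A -> G).
Hypotheses (ef : @structure_embedding (lang2 N) A (L2 t G) f)
  (ef' : @structure_embedding (lang2 N) A (L2 t G) f').

Lemma embedding_lab a : lab (f a) = lab (f' a).
Proof.
apply: same_marks_lab => s.
by have := semb_un ef s a; have := semb_un ef' s a => /= <- <-.
Qed.

Lemma embedding_same_pair a b o o' :
  same_pair (act_opt F o (f a)) (act_opt F o' (f b))
    (act_opt F o (f' a)) (act_opt F o' (f' b)).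
Proof.
have [->|ab] := eqVneq a b; first exact/same_pair_of_lab/embedding_lab.
have main a1 b1 p q : vlt (f a1) (f b1) ->
    same_pair (act_opt F p (f a1)) (act_opt F q (f b1))
      (act_opt F p (f' a1)) (act_opt F q (f' b1)).
  move=> lt; have /andP[ne _] := lt.
  have [i ti] := enum_complete ht ne.
  have : @binR (lang2 N) (L2 t G) (inr i) (f a1) (f b1) by [].
  move/(semb_bin ef (inr i) a1 b1)/(semb_bin ef' (inr i) a1 b1) => [_ ti'].
  apply: same_pair_of_type => //; try exact: embedding_lab.
  exact: rooted_isomorphic_trans (rooted_isomorphic_sym ti) ti'.
have ne : f a != f b by rewrite (inj_eq (semb_inj ef)).
have /orP[lt|lt] := vlt_total ne; first exact: main.
exact/same_pair_sym/main.
Qed.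

Definition closure_set : {set G} :=
  [set x | [exists p : A * option 'I_4, act_opt F p.2 (f p.1) == x]].

Lemma closure_act k x : x \in closure_set -> F k x \in closure_set.
Proof.
rewrite !inE => /existsP[[a o] /eqP <-]; apply/existsP; exists (a, Some k) => /=.
by case: o => [j|] //=; rewrite (frame_act fr).
Qed.

Lemma mem_closure a : f a \in closure_set.
Proof. by rewrite inE; apply/existsP; exists (a, None). Qed.

(** Each point of the closure of the image of [f] is [F k (f a)] or [f a], and is
    sent to [F k (f' a)] or [f' a]. By [embedding_same_pair] this depends only
    on the point, and preserves all relations. *)
Lemma closure_copy : exists2 c : {ffun {x | x \in closure_set} -> G},
  sub_copy lab closure_act c & forall a, c (exist _ (f a) (mem_closure a)) = f' a.
Proof.
pose c : {ffun {x | x \in closure_set} -> G} := [ffun s =>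
  if [pick p : A * option 'I_4 | act_opt F p.2 (f p.1) == val s] is Some p
  then act_opt F p.2 (f' p.1) else val s].
have cE s a o : act_opt F o (f a) = val s -> c s = act_opt F o (f' a).
  move=> e; rewrite ffunE; case: pickP => [[b o'] /eqP /= e'|/(_ (a, o))]; last first.
    by rewrite /= e eqxx.
  by apply/eqP; rewrite -(same_pair_eq (embedding_same_pair b a o' o)) e e'.
have rep (s : {x | x \in closure_set}) : exists a o, act_opt F o (f a) = val s.
  by have := valP s; rewrite inE => /existsP[[a o] /eqP e]; exists a, o.
exists c; last by move=> a; rewrite (cE _ a None).
have pairs s s' : same_pair (val s) (val s') (c s) (c s').
  have [a [o e]] := rep s; have [b [o' e']] := rep s'.
  by rewrite (cE s a o e) (cE s' b o' e') -e -e'; apply: embedding_same_pair.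
split.
- move=> s s' /eqP; rewrite -(same_pair_eq (pairs s s')) => /eqP; exact: val_inj.
- move=> k s; have [a [o e]] := rep s; rewrite (cE s a o e).
  rewrite (cE _ a (Some k)) /=; last first.
    by rewrite -e; case: o {e} => [j|] //=; rewrite (frame_act fr).
  by case: o {e} => [j|] //=; rewrite (frame_act fr).
- by move=> s s'; rewrite (same_pair_E1 (pairs s s')).
- move=> s; have [a [o e]] := rep s; rewrite (cE s a o e) -e.
  case: o {e} => [k|] /=; last exact/esym/embedding_lab.
  by apply: ord_inj; rewrite !(frame_lab fr) embedding_lab.
- by move=> s s'; rewrite !vle_vlt (same_pair_eq (pairs s s')) (same_pair_lt (pairs s s')).
Qed.

End Closure.

(** [B] embeds into [L2 t G], so [G] can take the place of [B]. If [A] does not embed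
    into [L2 t G], nothing is to be coloured; otherwise [A] is
    a subset of [G], and a map on the closure of [A] is coloured by the image
    of [A]. *)
Theorem theorem7p1 (N : nat) (t : 'I_N -> rooted)
    (ht : type_enumeration t) : ramsey_class (Bbar t).
Proof.
move=> A B BA BB k k0; have [G [j ej]] := Bbar_embedding BB.
have [F [lab dec]] := decoration_exists G.
have i0 : 'I_k by exists 0.
have [[f0 ef0]|no] := Classical_Prop.classic
  (exists f : A -> L2 t G, structure_embedding f); last first.
  exists (L2 t G); first exact: Bbar_L2.
  move=> chi; exists (j @: setT); first exact: image_copy.
  exists i0 => T _ /copy_embedding[f ef _]; case: no; by exists f.
have [H [F' [lab' [dec' mono]]]] := good_graph_ramsey dec
  (@closure_act _ _ _ _ dec A f0) i0.
exists (L2 t H); first exact: Bbar_L2.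
move=> chi.
pose at_A a : {x | x \in closure_set F f0} := exist _ (f0 a) (mem_closure F f0 a).
have [phi ephi phi_mono] := mono (fun l => chi [set l (at_A a) | a : A]).
have e2 := graph_embedding_L2 dec dec' ephi t.
exists ((phi \o j) @: setT).
  by apply: image_copy; apply: structure_embedding_comp e2.
have colour (T : {set L2 t H}) : T \subset (phi \o j) @: setT -> is_copy A T ->
    exists2 c, sub_copy lab (@closure_act _ _ _ _ dec A f0) c &
      chi T = chi [set ffun_comp phi c (at_A a) | a : A].
  move=> sub /copy_embedding[h eh eT].
  have hin a : exists x, phi x == h a.
    have /(subsetP sub)/imsetP[b _ ->] : h a \in T by rewrite -eT imset_f.
    by exists (j b).
  pose f' a : L2 t G := xchoose (hin a).
  have phif' a : phi (f' a) = h a by apply/eqP/(xchooseP (hin a)).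
  have ef' : structure_embedding f'.
    case: eh e2 => h1 h2 h3 [p1 p2 p3]; split.
    - by move=> a b /(congr1 phi); rewrite !phif' => /h1.
    - by move=> s a; rewrite h2 p2 phif'.
    - by move=> s a b; rewrite h3 p3 !phif'.
  have [c cc cE] := closure_copy ht dec ef0 ef'; exists c => //.
  have valE a : ffun_comp phi c (at_A a) = h a by rewrite ffunE cE phif'.
  rewrite -eT; congr chi; apply/setP=> y.
  by apply/imsetP/imsetP=> -[a _ ->]; exists a.
have [[T [subT copyT]]|none] := Classical_Prop.classic
  (exists T : {set L2 t H}, T \subset (phi \o j) @: setT /\ is_copy A T); last first.
  by exists i0 => T subT copyT; case: none; exists T.
exists (chi T) => T' subT' copyT'.
have [c cc ->] := colour T subT copyT; have [c' cc' ->] := colour T' subT' copyT'.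
exact: phi_mono.
Qed.
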